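(* Let $I$ be an unmixed homogeneous ideal in a polynomial ring $R=K[\underline{x}]$ over the field $K$. Assume that the pair $(R,I)$ has the property $\mathbf{P}$, and let $\underline{\alpha}=\alpha_1,\ldots,\alpha_{\operatorname{ht}(I)}$ be elements of $I$ as in the property $\mathbf{P}$. (1) For any integer $n\geq 0$, let $L_n(I)$ denote the $n$-th generic link of $I$ in a polynomial extension $R[Y]$. The pair $(R[Y],L_n(I))$ has the property $\mathbf{P}$. (2) If the ideal $I$ is not generated by a regular sequence, then $(\underline{\alpha}):I$ is a link of $I$ in the polynomial ring $R$. The pair $(R,(\underline{\alpha}):I)$ has the property $\mathbf{P}$.
   Context: Unmixed: all associated primes of the (proper) ideal have the same height. $\operatorname{ht}$ denotes height and $\operatorname{in}_<$ denotes the initial term with respect to a term order $<$. Property $\mathbf{P}$: Let $R$ be a polynomial ring over a field and $I$ an unmixed homogeneous ideal of $R$. The pair $(R,I)$ has $\mathbf{P}$ if, for some fixed term order $<$ in $R$, there exist homogeneous elements $\underline{\alpha}=\alpha_1,\ldots,\alpha_{\operatorname{ht}(I)}$ in $I$ such that each initial term $\operatorname{in}_<(\alpha_i)$ is squarefree and each pair of initial terms $\operatorname{in}_<(\alpha_i),\operatorname{in}_<(\alpha_j)$ is mutually coprime for $i\neq j$. Link: proper ideals $I,J$ of $R$ are linked if there is an ideal $\mathfrak{a}$ generated by a regular sequence with $J=\mathfrak{a}:I$ and $I=\mathfrak{a}:J$; then $J$ is called a link of $I$. Generic link: let $I$ be an unmixed ideal of height $g>0$ in a polynomial ring $R$ with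 generating set $f_1,\ldots,f_r$, let $Y$ be a $g\times r$ matrix of indeterminates, and let $\mathfrak{a}$ be the ideal generated by the entries of $Y[f_1\cdots f_r]^T$. The (first) generic link of $I$ is $L_1(I)=\mathfrak{a}R[Y]:IR[Y]$. Iterating, $L_0(I)=I$ and $L_n(I)=L_1(L_{n-1}(I))$ for $n>0$, an ideal in a polynomial extension of $R$ (again denoted $R[Y]$, with $Y$ all the adjoined indeterminates). Any two generic links of $I$, for different generating sets, are equivalent: after adjoining finitely many variables to each ambient ring there is an isomorphism of the resulting rings carrying one (extended) ideal to the other. For this reason one speaks of ''the'' generic link. *)

(* Defs.v *)
From HB Require Import structures.
From mathcomp Require Import all_boot all_order all_algebra.
From mathcomp Require Export mpoly.

Set Implicit Arguments.
Unset Strict Implicit.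
Unset Printing Implicit Defensive.

Import GRing.Theory.

Local Open Scope ring_scope.

(* Ideals are Prop-valued predicates: colon ideals have no evident boolean
   membership test, and idealr of ring_quotient only covers proper ideals. *)

Section Ideals.
Variable R : comNzRingType.
Implicit Types (I J P : R -> Prop) (s : seq R).

Definition is_ideal I :=
  I 0 /\ forall a x y, I x -> I y -> I (a * x + y).

Definition is_proper I := ~ I 1.

Definition same_ideal I J := forall x, I x <-> J x.

Definition subideal I J := forall x, I x -> J x.

Definition ideal_gen s : R -> Prop :=
  fun x => exists c : nat -> R, x = \sum_(i < size s) c i * s`_i.

Definition colon I J : R -> Prop := fun x => forall y, J y -> I (x * y).

Definition prime_ideal P :=
  [/\ is_ideal P, is_proper P & forall x y, P (x * y) -> P x \/ P y].

(* P is the top of a chain P_0 < ... < P_h of primes. *)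
Definition prime_chain P (h : nat) :=
  exists C : nat -> R -> Prop,
    [/\ forall i, (i <= h)%N -> prime_ideal (C i),
        forall i, (i < h)%N ->
          subideal (C i) (C i.+1) /\ ~ subideal (C i.+1) (C i)
      & same_ideal (C h) P].

Definition prime_height P (h : nat) :=
  [/\ prime_ideal P, prime_chain P h
    & forall k, prime_chain P k -> (k <= h)%N].

Definition ideal_height I (h : nat) :=
  (exists P, subideal I P /\ prime_height P h) /\
  (forall P k, subideal I P -> prime_height P k -> (h <= k)%N).

(* P is an associated prime of R/I: the annihilator of a class x + I. *)
Definition associated_prime I P :=
  prime_ideal P /\ exists x, forall y, P y <-> I (y * x).

Definition unmixed I :=
  [/\ is_ideal I, is_proper I
    & exists h, forall P, associated_prime I P -> prime_height P h].

Definition regular_sequence s :=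
  (forall i, (i < size s)%N ->
     forall x, ideal_gen (take i s) (x * s`_i) -> ideal_gen (take i s) x)
  /\ is_proper (ideal_gen s).

Definition linked I J :=
  [/\ is_ideal I /\ is_proper I, is_ideal J /\ is_proper J
    & exists s, [/\ regular_sequence s,
                    same_ideal J (colon (ideal_gen s) I)
                  & same_ideal I (colon (ideal_gen s) J)]].

End Ideals.

Definition extend_ideal (A B : comNzRingType) (phi : A -> B)
    (I : A -> Prop) : B -> Prop :=
  fun y => exists s : seq A,
    (forall a, a \in s -> I a) /\ ideal_gen [seq phi a | a <- s] y.

Section PropertyP.
Variables (K : fieldType) (n : nat).
Implicit Types (mf : measure n) (ord : rel 'X_{1..n}) (p : {mpoly K[n]}).

(* A measure assigns a weight mf U_(i) to each variable and extends additively
   to monomials; the standard grading is mf = mdeg. *)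
Definition positive_grading mf := forall i : 'I_n, (0 < mf U_(i)%MM)%N.

Definition homogeneous_ideal mf (I : {mpoly K[n]} -> Prop) :=
  forall p d, I p -> I (pihomog mf d p).

Definition term_order ord :=
  [/\ reflexive ord, antisymmetric ord, transitive ord & total ord] /\
  (forall m, ord 0%MM m) /\
  (forall m1 m2 m, ord m1 m2 -> ord (m1 + m)%MM (m2 + m)%MM).

(* The ord-greatest monomial of p, for p != 0: the default value 0%MM is the
   least monomial of a term order. *)
Definition initial_monomial ord p : 'X_{1..n} :=
  \big[(fun m1 m2 => if ord m1 m2 then m2 else m1)/0%MM]_(m <- msupp p) m.

Definition squarefree_mnm (m : 'X_{1..n}) := forall i, (m i <= 1)%N.

Definition coprime_mnm (m1 m2 : 'X_{1..n}) := forall i, m1 i = 0%N \/ m2 i = 0%N.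

(* alpha_i != 0 is needed: initial_monomial ord 0 is the junk value 0%MM, which
   is squarefree and coprime to everything. *)
Definition P_sequence mf (I : {mpoly K[n]} -> Prop) ord (g : nat)
    (alpha : g.-tuple {mpoly K[n]}) :=
  [/\ forall i, [/\ I (tnth alpha i), tnth alpha i != 0
                  & tnth alpha i \is homog mf],
      forall i, squarefree_mnm (initial_monomial ord (tnth alpha i))
    & forall i j, i != j ->
        coprime_mnm (initial_monomial ord (tnth alpha i))
                    (initial_monomial ord (tnth alpha j))].

Definition property_P mf (I : {mpoly K[n]} -> Prop) :=
  [/\ unmixed I, homogeneous_ideal mf I
    & exists (ord : rel 'X_{1..n}) (g : nat) (alpha : g.-tuple {mpoly K[n]}),
        [/\ term_order ord, ideal_height I g & P_sequence mf I ord alpha]].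

End PropertyP.

(* The polynomial ring in n variables inside the one in n + k variables: the
   variables 'X_(lshift k i) are the old ones, 'X_(rshift n j) the new ones. *)
Definition mpoly_incl (K : fieldType) (n k : nat) (p : {mpoly K[n]})
    : {mpoly K[n + k]} :=
  p \mPo [tuple 'X_(lshift k i) | i < n].

Definition mpoly_ext (K : fieldType) (n k : nat) (I : {mpoly K[n]} -> Prop)
    : {mpoly K[n + k]} -> Prop :=
  extend_ideal (@mpoly_incl K n k) I.
Arguments mpoly_ext {K n} k%_N I p.

(* The entries of Y [f_1 ... f_r]^T, where Y i j is the new variable of index
   mxvec_index i j : 'I_(g * r). *)
Definition generic_combinations (K : fieldType) (n g r : nat)
    (f : r.-tuple {mpoly K[n]}) : g.-tuple {mpoly K[n + g * r]} :=
  [tuple \sum_(j < r) 'X_(rshift n (mxvec_index i j))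
           * mpoly_incl (g * r)%N (tnth f j) | i < g].

Definition generic_link (K : fieldType) (n g r : nat)
    (f : r.-tuple {mpoly K[n]}) (I : {mpoly K[n]} -> Prop)
    : {mpoly K[n + g * r]} -> Prop :=
  colon (ideal_gen (generic_combinations g f)) (mpoly_ext (g * r) I).
Arguments generic_link {K n} g {r} f I p.

(* nth_generic_link I k J: the ideal J, in m variables of which the first n are
   the original ones, is L_k(I) for some choice of a finite generating set at
   each of the k steps. *)
Inductive nth_generic_link (K : fieldType) (n : nat) (I : {mpoly K[n]} -> Prop)
    : nat -> forall m : nat, ({mpoly K[m]} -> Prop) -> Prop :=
| generic_link0 : nth_generic_link I 0 I
| generic_linkS k m (J : {mpoly K[m]} -> Prop) g r
    (f : r.-tuple {mpoly K[m]}) :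
    nth_generic_link I k J ->
    unmixed J -> ideal_height J g -> (0 < g)%N ->
    same_ideal J (ideal_gen f) ->
    nth_generic_link I k.+1 (generic_link g f J).

Definition equivalent_ideals (K : fieldType) (n m : nat)
    (I : {mpoly K[n]} -> Prop) (J : {mpoly K[m]} -> Prop) :=
  exists (k l : nat) (phi : {rmorphism {mpoly K[n + k]} -> {mpoly K[m + l]}}),
    bijective phi /\ forall p, mpoly_ext k I p <-> mpoly_ext l J (phi p).

Definition extends_grading (n m : nat) (mf : measure n) (mf' : measure m) :=
  forall (i : 'I_n) (j : 'I_m), i = j :> nat -> mf' U_(j)%MM = mf U_(i)%MM.

(* Main.v *)
Require Import Defs.
From HB Require Import structures.
From mathcomp Require Import all_boot all_order all_algebra.
From mathcomp Require Import ring zify.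
From Stdlib Require Import Classical ClassicalEpsilon.
From Stdlib Require Import FunctionalExtensionality PropExtensionality.

(* Let s be a sequence of polynomials with squarefree, pairwise coprime initial
   monomials.  Such an s is a Groebner basis of a = (s), so a is radical and s
   is regular.  If x is not in a, with normal form r, every in(s_i) has a
   variable v_i not dividing in(r); the remaining variables T, at least n - |s|
   of them, satisfy (a : x) /\ K[T] = 0, because in(q) in(r) is again standard
   for q in K[T].  Counting monomials bounds the chains of primes below P by
   n - |T| when P /\ K[T] = 0, and adjoining the variables one at a time gives a
   chain realizing the bound.  Hence the primes a : x have height exactly |s|,
   and every proper a : I is unmixed of height |s|.  Since a is radical, linkage
   a : (a : I) = I is checked on its minimal primes.

   For the generic link take generators f = (alpha, h) of I with h homogeneous,
   and a term order in which the diagonal entries of Y dominate: the entries of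
   Y f have initial terms Y_ii in(alpha_i), so the same argument applies to
   their colon ideal.  Two generating sets f' = A f, f = B f' give links which
   become equal after the shears Y := Y + Z A and Z := Z + Y B of the
   indeterminates. *)

Set Implicit Arguments.
Unset Strict Implicit.
Unset Printing Implicit Defensive.

Import GRing.Theory.

Local Open Scope ring_scope.

(** A height bounds every chain of primes from above, so each upper bound needs an argument uniform
    in the chain; the count of independent monomials provides it, the growth exponent playing the
    part of a transcendence degree. The count is made for chains of arbitrary ideals with a
    nonzerodivisor at each step. Chains of primes give the upper bounds on heights; the prefix
    ideals [(s_1, ..., s_i)], which need not be prime, give the opposite bound [|s| <= ht P] for
    every prime [P] containing [s].

    When the generators [f_j] have different degrees, the entries of [Y f] are not homogeneous for a
    grading that gives all entries of [Y] the same weight. Each [Y_ij] therefore gets a weight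
    compensating the degree of [f_j], and this is why gradings are arbitrary positive measures,
    extended at every step.

    The isomorphisms relating two generic links respect neither monomials nor gradings, so property
    P is proved for one well-chosen link at each step, and the comparison of links is a separate
    argument about ideals up to adjoining variables. *)

Lemma same_idealE (R : comNzRingType) (I J : R -> Prop) :
  same_ideal I J -> I = J.
Proof.
by move=> IJ; apply: functional_extensionality => x;
  apply: propositional_extensionality; apply: IJ.
Qed.

(** * Ideals, generators, colons and chains of primes *)

Section IdealFacts.
Variable R : comNzRingType.
Implicit Types (I J P : R -> Prop) (s : seq R).

Lemma mem_ideal0 I : is_ideal I -> I 0.
Proof. by case. Qed.

Lemma mem_idealMl I a x : is_ideal I -> I x -> I (a * x).
Proof. by move=> [I0 IM] Ix; rewrite -[a * x]addr0; apply: IM. Qed.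

Lemma mem_idealMr I a x : is_ideal I -> I x -> I (x * a).
Proof. by rewrite mulrC; apply: mem_idealMl. Qed.

Lemma mem_idealD I x y : is_ideal I -> I x -> I y -> I (x + y).
Proof. by move=> [I0 IM] Ix Iy; rewrite -[x]mul1r; apply: IM. Qed.

Lemma mem_idealN I x : is_ideal I -> I x -> I (- x).
Proof. by move=> hI Ix; rewrite -mulN1r; apply: mem_idealMl. Qed.

Lemma mem_idealB I x y : is_ideal I -> I x -> I y -> I (x - y).
Proof. by move=> hI Ix Iy; apply: mem_idealD => //; apply: mem_idealN. Qed.

Lemma mem_ideal_sum I (T : Type) (r : seq T) (Q : pred T) (F : T -> R) :
  is_ideal I -> (forall i, Q i -> I (F i)) -> I (\sum_(i <- r | Q i) F i).
Proof.
move=> hI IF; elim/big_ind: _ => //; first exact: mem_ideal0.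
by move=> x y; apply: mem_idealD.
Qed.

Lemma ideal_gen_is_ideal s : is_ideal (ideal_gen s).
Proof.
split=> [|a x y [c ->] [d ->]].
  by exists (fun=> 0); rewrite big1 // => i _; rewrite mul0r.
exists (fun i => a * c i + d i); rewrite mulr_sumr -big_split /=.
by apply: eq_bigr => i _; rewrite mulrDl mulrA.
Qed.
Hint Extern 0 (is_ideal (ideal_gen _)) => apply: ideal_gen_is_ideal : core.

Lemma mem_ideal_gen s x : x \in s -> ideal_gen s x.
Proof.
move=> xs; exists (fun i => (i == index x s)%:R).
have lt_xs : (index x s < size s)%N by rewrite index_mem.
rewrite (bigD1 (Ordinal lt_xs)) //= eqxx mul1r nth_index // big1 ?addr0 //.
by move=> i; rewrite -val_eqE /= => /negPf ->; rewrite mul0r.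
Qed.

Lemma ideal_gen_min s I :
  is_ideal I -> (forall x, x \in s -> I x) -> subideal (ideal_gen s) I.
Proof.
move=> hI sI x [c ->]; apply: mem_ideal_sum => // i _.
by apply: mem_idealMl => //; apply: sI; apply: mem_nth.
Qed.

Lemma ideal_gen_sub s1 s2 :
  {subset s1 <= s2} -> subideal (ideal_gen s1) (ideal_gen s2).
Proof.
by move=> s12; apply: ideal_gen_min => // x /s12; apply: mem_ideal_gen.
Qed.

(** Generators are added at the end because [regular_sequence] speaks of the prefixes [take i s]. *)
Lemma ideal_gen_rcons s z x :
  ideal_gen (rcons s z) x <-> exists a c, ideal_gen s a /\ x = a + c * z.
Proof.
split=> [|[a [c [sa ->]]]].
  case=> c ->; rewrite size_rcons big_ord_recr /= nth_rcons ltnn eqxx.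
  exists (\sum_(i < size s) c i * s`_i), (c (size s)); split; first by exists c.
  by congr (_ + _); apply: eq_bigr => i _; rewrite nth_rcons ltn_ord.
apply: mem_idealD => //.
  apply: ideal_gen_sub sa => y ys.
  by rewrite mem_rcons inE ys orbT.
by apply: mem_idealMl => //; apply: mem_ideal_gen; rewrite mem_rcons inE eqxx.
Qed.

Lemma colon_is_ideal I J : is_ideal I -> is_ideal (colon I J).
Proof.
move=> hI; split=> [y _|a x y Ix Iy z Jz]; first by rewrite mul0r; apply: mem_ideal0.
rewrite mulrDl -mulrA; apply: mem_idealD => //; last exact: Iy.
by apply: mem_idealMl => //; apply: Ix.
Qed.

Lemma sub_colon I J : is_ideal I -> subideal I (colon I J).
Proof. by move=> hI x Ix y _; apply: mem_idealMr. Qed.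

Lemma colon1_is_ideal I x : is_ideal I -> is_ideal (fun y => I (y * x)).
Proof.
move=> hI; split=> [|a y z Iy Iz]; first by rewrite mul0r; apply: mem_ideal0.
by rewrite mulrDl -mulrA; apply: mem_idealD => //; apply: mem_idealMl.
Qed.

Lemma prime_heightP P h k : prime_height P h -> prime_height P k -> h = k.
Proof.
move=> [_ c1 m1] [_ c2 m2]; apply/eqP.
by rewrite eqn_leq m2 // m1.
Qed.

Lemma ideal_heightP I h k : ideal_height I h -> ideal_height I k -> h = k.
Proof.
move=> [[P [sP hP]] m1] [[Q [sQ hQ]] m2]; apply/eqP.
by rewrite eqn_leq (m1 _ _ sQ hQ) (m2 _ _ sP hP).
Qed.

Lemma prime_chain_rcons P Q h :
  prime_ideal Q -> prime_chain P h -> subideal P Q -> ~ subideal Q P ->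
  prime_chain Q h.+1.
Proof.
move=> pQ [C [pC sC /same_idealE Ch]] sPQ nQP.
exists (fun i => if (i <= h)%N then C i else Q); split.
- by move=> i _; case: ifP => // /pC.
- move=> i lt_ih; have [->|ih] : i = h \/ (i < h)%N.
      by apply/predU1P; rewrite -leq_eqVlt -ltnS.
    by rewrite leqnn ltnn Ch.
  by rewrite -ltnS lt_ih ih; apply: sC.
- by rewrite ltnn.
Qed.

Lemma prime_chain0 P : prime_ideal P -> prime_chain P 0.
Proof. by move=> pP; exists (fun=> P); split. Qed.

Lemma prime_chain_le P Q h :
  prime_ideal Q -> prime_chain P h -> subideal P Q ->
  exists2 k, (h <= k)%N & prime_chain Q k.
Proof.
move=> pQ cP sPQ; case: (classic (subideal Q P)) => [sQP|nQP].
  exists h => //; suff -> : Q = P by [].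
  by apply: same_idealE => x; split; [apply: sQP|apply: sPQ].
by exists h.+1 => //; apply: prime_chain_rcons cP sPQ nQP.
Qed.

End IdealFacts.
#[export] Hint Extern 0 (is_ideal (ideal_gen _)) =>
  apply: ideal_gen_is_ideal : core.

(** * Dickson's lemma, term orders and the basis theorem *)

(** Each index is chosen to minimize [u] beyond the previous one, so its value bounds all later
    values from below. *)
Lemma nondecreasing_subseq (u : nat -> nat) :
  exists f : nat -> nat, {homo f : i j / (i < j)%N} /\
    {homo u \o f : i j / (i <= j)%N}.
Proof.
have argmin N : exists k, (N <= k)%N /\ forall j, (N <= j)%N -> (u k <= u j)%N.
  have [v] : exists v, exists2 k, (N <= k)%N & u k = v by exists (u N); exists N.
  elim/ltn_ind: v => v IHv [k Nk uk].
  case: (classic (exists2 j, (N <= j)%N & (u j < v)%N)) => [[j Nj ujv]|H].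
    by apply: (IHv _ ujv); exists j.
  exists k; split=> // j Nj; rewrite leqNgt uk; apply/negP => ujv.
  by apply: H; exists j.
pose m N := proj1_sig (constructive_indefinite_description _ (argmin N)).
have mP N : (N <= m N)%N /\ forall j, (N <= j)%N -> (u (m N) <= u j)%N.
  by rewrite /m; case: constructive_indefinite_description.
pose f := fix f i := if i is j.+1 then m (f j).+1 else m 0.
have fS i : (f i < f i.+1)%N by have [] := mP (f i).+1.
have f_min i j : (f i <= j)%N -> (u (f i) <= u j)%N.
  case: i => [|i] fij; first by have [_ ->] := mP 0.
  have [h1 h2] := mP (f i).+1; apply: h2; exact: leq_trans h1 fij.
have f_lt : {homo f : i j / (i < j)%N}.
  by apply: homo_ltn fS => ? ? ?; apply: ltn_trans.
exists f; split=> // i j; rewrite leq_eqVlt => /predU1P[-> //|/f_lt/ltnW].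
exact: f_min.
Qed.

(** Subsequences are extracted one coordinate at a time; a further extraction does not disturb the
    [k] coordinates already monotone. *)
Lemma mnm_nondecreasing_subseq n (u : nat -> 'X_{1..n}) :
  exists f : nat -> nat, {homo f : i j / (i < j)%N} /\
    forall i j, (i <= j)%N -> (u (f i) <= u (f j))%MM.
Proof.
suff H k : exists f : nat -> nat, {homo f : i j / (i < j)%N} /\
    forall i j, (i <= j)%N -> forall c : 'I_n, (c < k)%N -> (u (f i) c <= u (f j) c)%N.
  have [f [f1 f2]] := H n; exists f; split=> // i j ij.
  by apply/mnm_lepP => c; apply: f2.
elim: k => [|k [f [f_lt fP]]]; first by exists id; split.
have [lt_kn|le_nk] := ltnP k n; last first.
  by exists f; split=> // i j ij c _; apply: fP => //; apply: leq_trans le_nk.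
have [h [h_lt hP]] := nondecreasing_subseq (fun i => u (f i) (Ordinal lt_kn)).
have h_le : {homo h : i j / (i <= j)%N}.
  by move=> i j; rewrite leq_eqVlt => /predU1P[-> //|/h_lt/ltnW].
exists (f \o h); split=> [i j ij|i j ij c].
  by apply: f_lt; apply: h_lt.
rewrite ltnS leq_eqVlt => /predU1P[ck|ck]; last exact/fP/ck/h_le.
by have -> : c = Ordinal lt_kn; [apply: val_inj | apply: hP].
Qed.

(** Otherwise one can keep choosing elements of [A] divisible by none of their predecessors, and a
    nondecreasing subsequence of these is absurd. *)
Lemma dickson n (A : 'X_{1..n} -> Prop) :
  exists B : seq 'X_{1..n}, (forall b, b \in B -> A b) /\
    forall m, A m -> exists2 b, b \in B & (b <= m)%MM.
Proof.
apply: NNPP => noB.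
(* The condition on [B] stands under the existential, so that choice yields a function [next]
   defined on all lists. *)
have step (B : seq 'X_{1..n}) : exists m, (forall b, b \in B -> A b) ->
    A m /\ forall b, b \in B -> ~~ (b <= m)%MM.
  case: (classic (forall b, b \in B -> A b)) => [BA|]; last first.
    by move=> nBA; exists 0%MM.
  apply: NNPP => H; apply: noB; exists B; split=> // m Am.
  apply: NNPP => H2; apply: H; exists m => _; split=> // b bB.
  by apply/negP => bm; apply: H2; exists b.
pose next B := proj1_sig (constructive_indefinite_description _ (step B)).
have nextP B : (forall b, b \in B -> A b) ->
    A (next B) /\ forall b, b \in B -> ~~ (b <= next B)%MM.
  by rewrite /next; case: constructive_indefinite_description.
pose B := fix B i := if i is j.+1 then next (B j) :: B j else [::].
have BA i : forall b, b \in B i -> A b.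
  elim: i => [|i IHi] b //=; rewrite inE => /predU1P[->|/IHi //].
  by have [] := nextP _ IHi.
have B_mem i j : (i < j)%N -> next (B i) \in B j.
  elim: j => // j IHj; rewrite ltnS leq_eqVlt => /predU1P[->|/IHj] /=;
  by rewrite inE ?eqxx // => ->; rewrite orbT.
have [f [f_lt fP]] := mnm_nondecreasing_subseq (fun i => next (B i)).
have [_ /(_ _ (B_mem _ _ (f_lt 0 1 isT)))] := nextP _ (BA (f 1)).
by rewrite fP.
Qed.

Section TermOrder.
Variables (n : nat) (ord : rel 'X_{1..n}).
Hypothesis ord_term : term_order ord.

Lemma ord_refl : reflexive ord. Proof. by case: ord_term => -[]. Qed.
Lemma ord_anti : antisymmetric ord. Proof. by case: ord_term => -[]. Qed.
Lemma ord_trans : transitive ord. Proof. by case: ord_term => -[]. Qed.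
Lemma ord_total : total ord. Proof. by case: ord_term => -[]. Qed.
Lemma ord0m m : ord 0%MM m. Proof. by case: ord_term => _ []. Qed.

Lemma ord_add2r m m1 m2 : ord (m1 + m)%MM (m2 + m)%MM = ord m1 m2.
Proof.
have H a b : ord a b -> ord (a + m)%MM (b + m)%MM.
  by case: ord_term => _ [_]; apply.
apply/idP/idP => [h|]; last exact: H.
have /orP[//|/H h2] := ord_total m1 m2.
have /addIm -> : (m1 + m = m2 + m)%MM by apply: ord_anti; rewrite h h2.
exact: ord_refl.
Qed.

Lemma ord_add m1 m2 m3 m4 :
  ord m1 m2 -> ord m3 m4 -> ord (m1 + m3)%MM (m2 + m4)%MM.
Proof.
move=> h1 h2; apply: (@ord_trans (m2 + m3)%MM); first by rewrite ord_add2r.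
by rewrite ![(m2 + _)%MM]addmC ord_add2r.
Qed.

(** This is why only one pair of monomials contributes to the coefficient of a product at the sum of
    the initial monomials. *)
Lemma ord_add_eq m1 m2 m3 m4 :
  ord m1 m2 -> ord m3 m4 -> (m1 + m3 = m2 + m4)%MM -> m1 = m2 /\ m3 = m4.
Proof.
move=> h1 h2 e; have e1 : m1 = m2.
  apply: ord_anti; rewrite h1 /= -(@ord_add2r m3) e.
  by rewrite ![(m2 + _)%MM]addmC ord_add2r.
by split=> //; apply: (@addmI _ m1); rewrite e e1.
Qed.

Lemma ord_lem m1 m2 : (m1 <= m2)%MM -> ord m1 m2.
Proof.
by move/submK => <-; rewrite -{1}[m1]add0m ord_add2r ord0m.
Qed.

Lemma ord_min (B : seq 'X_{1..n}) m : m \in B ->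
  exists2 b, b \in B & forall c, c \in B -> ord b c.
Proof.
elim: B m => // a [|a' B] IHB m _.
  exists a; rewrite ?inE // => c; rewrite inE => /eqP ->; exact: ord_refl.
have [b bB bmin] := IHB a' (mem_head _ _).
have /orP[h|h] := ord_total a b; last first.
  exists b; first by rewrite inE bB orbT.
  by move=> c; rewrite inE => /predU1P[->|/bmin].
exists a; rewrite ?mem_head // => c; rewrite inE => /predU1P[->|/bmin].
  exact: ord_refl.
exact: ord_trans.
Qed.

(** Dickson's lemma gives finitely many inaccessible monomials dividing all inaccessible ones. The
    least of them is accessible after all: an inaccessible monomial below it would be a multiple of
    one of the list, hence not below it. *)
Lemma ord_wf : well_founded (fun m1 m2 => ord m1 m2 && (m1 != m2)).
Proof.
move=> m; apply: NNPP => nAm.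
have [B [BA Bdiv]] := dickson (fun m =>
  ~ Acc (fun m1 m2 => ord m1 m2 && (m1 != m2)) m).
have [b0 b0B _] := Bdiv _ nAm.
have [b bB bmin] := ord_min b0B.
apply: (BA _ bB); constructor=> k /andP[kb neq_kb]; apply: NNPP => nAk.
have [c cB /ord_lem ck] := Bdiv _ nAk.
move/eqP: neq_kb; apply; apply: ord_anti; rewrite kb.
exact: ord_trans (bmin _ cB) ck.
Qed.

Section Lead.
Variable K : fieldType.
Implicit Types p q : {mpoly K[n]}.
Notation lm := (initial_monomial ord).

Lemma big_ordmax_ub (r : seq 'X_{1..n}) :
  let M := \big[(fun m1 m2 => if ord m1 m2 then m2 else m1)/0%MM]_(m <- r) m in
  (forall m, m \in r -> ord m M) /\ (r != [::] -> M \in r).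
Proof.
elim: r => [|a r /= [IH1 IH2]] /=; first by split.
rewrite big_cons; set M := \big[_/_]_(m <- r) m in IH1 IH2 *.
split=> [m|_].
  rewrite inE => /predU1P[->|/IH1 h]; first by case: ifP => // _; apply: ord_refl.
  case: ifP => // /negbT naM; apply: ord_trans h _.
  by have := ord_total a M; rewrite (negPf naM).
case: ifP => [aM|_]; last exact: mem_head.
case: (eqVneq r [::]) => [r0|/IH2]; last by rewrite inE => ->; rewrite orbT.
(* On an empty tail the fold returns its default [0%MM]; [a] lies below it, so [a] is itself
   [0%MM]. *)
have M0 : M = 0%MM by rewrite /M r0 big_nil.
rewrite inE; apply/orP; left; apply/eqP/ord_anti.
by rewrite aM M0 ord0m.
Qed.

Lemma lm_max p m : m \in msupp p -> ord m (lm p).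
Proof. by have [H _] := big_ordmax_ub (msupp p); apply: H. Qed.

Lemma lm_supp p : p != 0 -> lm p \in msupp p.
Proof. by rewrite -msupp_eq0; have [_] := big_ordmax_ub (msupp p). Qed.

Lemma lm_coeff_neq0 p : p != 0 -> p@_(lm p) != 0.
Proof. by rewrite -mcoeff_msupp; apply: lm_supp. Qed.

Lemma lm_eq p m :
  m \in msupp p -> (forall m', m' \in msupp p -> ord m' m) -> lm p = m.
Proof.
move=> mp mmax; apply: ord_anti; rewrite lm_max // andbT mmax // lm_supp //.
by apply: contraTneq mp => ->; rewrite msupp0.
Qed.

Lemma mcoeff_lmM p q : (p * q)@_(lm p + lm q) = p@_(lm p) * q@_(lm q).
Proof.
rewrite mpolyME raddf_sum /= -[RHS]addr0.
under eq_bigr => m _ do rewrite mcoeffZ mcoeffX.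
have H m1 m2 : m1 \in msupp p -> m2 \in msupp q ->
    (m1 + m2 == lm p + lm q)%MM -> m1 = lm p /\ m2 = lm q.
  by move=> /lm_max h1 /lm_max h2 /eqP; apply: ord_add_eq.
have [p0|p0] := eqVneq p 0.
  by rewrite p0 mcoeff0 mul0r msupp0 big_nil addr0.
have [q0|q0] := eqVneq q 0.
  rewrite q0 mcoeff0 mulr0 addr0 big1_seq // => m /andP[_].
  by case/allpairsP => -[a b] /= []; rewrite msupp0.
have puq : uniq [seq (m1, m2) | m1 <- msupp p, m2 <- msupp q].
  by apply: allpairs_uniq; rewrite ?msupp_uniq // => -[? ?] [? ?] _ _ [-> ->].
have pin : (lm p, lm q) \in [seq (m1, m2) | m1 <- msupp p, m2 <- msupp q].
  by apply/allpairsP; exists (lm p, lm q); rewrite /= !lm_supp.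
rewrite (bigD1_seq _ pin puq) /= eqxx mulr1; congr (_ + _).
rewrite big_seq_cond big1 // => -[m1 m2] /= /andP[/allpairsP[[a b] /= [ap bq]]].
case=> -> -> {m1 m2} /=.
have [e|_ _] := eqVneq (a + b)%MM (lm p + lm q)%MM; last by rewrite mulr0.
by have [-> ->] := H _ _ ap bq (introT eqP e); rewrite eqxx.
Qed.

Lemma lmM p q : p != 0 -> q != 0 -> lm (p * q) = (lm p + lm q)%MM.
Proof.
move=> p0 q0; apply: lm_eq.
  by rewrite mcoeff_msupp mcoeff_lmM mulf_neq0 ?lm_coeff_neq0.
move=> m /msuppM_le /allpairsP [[a b] /= [ap bq ->]].
by apply: ord_add; apply: lm_max.
Qed.

Lemma lmX m : lm 'X_[K, m] = m.
Proof.
apply: lm_eq; first by rewrite msuppX mem_head.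
by move=> m'; rewrite msuppX inE => /eqP ->; apply: ord_refl.
Qed.

Lemma lmD p q : p != 0 -> q != 0 -> lm p != lm q ->
  p + q != 0 /\ (lm (p + q) = lm p \/ lm (p + q) = lm q).
Proof.
suff H p' q' : p' != 0 -> ord (lm q') (lm p') -> lm p' != lm q' ->
    p' + q' != 0 /\ lm (p' + q') = lm p'.
  move=> p0 q0 npq; have /orP[h|h] := ord_total (lm q) (lm p).
    by have [? ->] := H _ _ p0 h npq; split=> //; left.
  rewrite addrC; have [|? ->] := H _ _ q0 h; first by rewrite eq_sym.
  by split=> //; right.
move=> p0 h npq.
have pin : lm p' \in msupp (p' + q').
  rewrite mcoeff_msupp mcoeffD [q'@__]memN_msupp_eq0 ?addr0 ?lm_coeff_neq0 //.
  apply/negP => /lm_max h2; move/eqP: npq; apply; apply: ord_anti.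
  by rewrite h h2.
split; first by apply: contraTneq pin => ->; rewrite msupp0.
apply: lm_eq => // m /msuppD_le; rewrite mem_cat => /orP[/lm_max //|/lm_max h2].
exact: ord_trans h2 h.
Qed.

(** One step of division. The case [r = 0] stands apart because [lm 0] is the default [0%MM], which
    is not strictly below [lm p] when [p] is constant. *)
Lemma lm_cancel p q : p != 0 -> q != 0 -> lm p = lm q ->
  let r := p - (p@_(lm p) / q@_(lm q)) *: q in
  r = 0 \/ (ord (lm r) (lm p) && (lm r != lm p)).
Proof.
move=> p0 q0 e r; case: (eqVneq r 0) => [->|r0]; [by left|right].
have rp : ord (lm r) (lm p).
  have /msuppB_le := lm_supp r0; rewrite mem_cat => /orP[/lm_max //|].
  by move/msuppZ_le/lm_max; rewrite e.
rewrite rp /=; apply: contraTneq (lm_supp r0) => ->.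
rewrite -mcoeff_eq0 mcoeffB mcoeffZ -e divfK ?subrr //.
by rewrite e lm_coeff_neq0.
Qed.

End Lead.
End TermOrder.

Lemma deglex_term_order n : term_order (fun m1 m2 : 'X_{1..n} => (m1 <= m2)%O).
Proof.
split; first split.
- exact: Order.POrderTheory.lexx.
- exact: Order.POrderTheory.le_anti.
- exact: Order.POrderTheory.le_trans.
- exact: Order.TotalTheory.le_total.
- split=> [m|m1 m2 m h]; first exact: le0m.
  by rewrite lemc_add2l.
Qed.

(** * Noetherianity and associated primes *)

Section Noetherian.
Variables (n : nat) (K : fieldType).
Implicit Types I : {mpoly K[n]} -> Prop.

(** Dickson's lemma, applied to the initial monomials of the nonzero elements of [I], selects
    finitely many elements; division by them terminates by [ord_wf] and leaves remainder zero. *)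
Theorem hilbert_basis I : is_ideal I -> exists s, I = ideal_gen s.
Proof.
move=> hI; pose ord : rel 'X_{1..n} := fun m1 m2 => (m1 <= m2)%O.
have ho : term_order ord by exact: deglex_term_order.
pose lm := @initial_monomial K n ord.
have [B [BA Bdiv]] := dickson (fun m => exists p, [/\ I p, p != 0 & lm p = m]).
pose gen b : {mpoly K[n]} := epsilon (inhabits 0)
  (fun p => [/\ I p, p != 0 & lm p = b]).
have genP b : b \in B -> [/\ I (gen b), gen b != 0 & lm (gen b) = b].
  by move=> /BA; apply: epsilon_spec.
pose s := [seq gen b | b <- B].
exists s; apply: same_idealE => p; split; last first.
  apply: ideal_gen_min => // _ /mapP [b bB ->].
  by have [] := genP _ bB.
move: {2}(lm p) (erefl (lm p)) => m; elim/(well_founded_ind (ord_wf ho)): m p.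
move=> m IHm p lmp Ip; have [->|p0] := eqVneq p 0; first exact: mem_ideal0.
have [b bB bm] : exists2 b, b \in B & (b <= m)%MM by apply: Bdiv; exists p.
have [Ig g0 lg] := genP _ bB.
pose q := 'X_[m - b] * gen b.
have X0 : 'X_[K, (m - b)%MM] != 0 by rewrite -msupp_eq0 msuppX.
have q0 : q != 0 by rewrite mulf_neq0.
have lq : lm q = m.
  by rewrite /lm lmM // lmX // [initial_monomial _ _]lg submK.
have sq : ideal_gen s q by apply: mem_idealMl => //; apply/mem_ideal_gen/map_f.
pose c := p@_(lm p) / q@_(lm q); pose r := p - c *: q.
have -> : p = r + c *: q by rewrite subrK.
have scq : ideal_gen s (c *: q) by rewrite -mul_mpolyC; apply: mem_idealMl.
have [r0|] : r = 0 \/ (ord (lm r) (lm p) && (lm r != lm p)).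
- by apply: lm_cancel => //; rewrite [RHS]lq.
- by rewrite r0 add0r.
rewrite lmp => rm; apply: mem_idealD => //; apply: IHm rm _ _ _ => //.
apply: mem_idealB => //; rewrite -mul_mpolyC; do 2!apply: mem_idealMl => //.
Qed.

Lemma ideal_ascending (C : nat -> {mpoly K[n]} -> Prop) :
  (forall i, is_ideal (C i)) -> (forall i, subideal (C i) (C i.+1)) ->
  exists k, subideal (C k.+1) (C k).
Proof.
move=> hC sC.
have mono i j : (i <= j)%N -> subideal (C i) (C j).
  elim: j => [|j IHj]; first by rewrite leqn0 => /eqP ->.
  by rewrite leq_eqVlt => /predU1P[-> //|/IHj h] x /h /sC.
pose U x := exists i, C i x.
have hU : is_ideal U.
  split=> [|a x y [i Ci] [j Cj]]; first by exists 0%N; apply: mem_ideal0.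
  exists (maxn i j); apply: mem_idealD => //; last exact: mono (leq_maxr _ _) _ Cj.
  by apply: mem_idealMl => //; apply: mono (leq_maxl _ _) _ Ci.
have [s Us] := hilbert_basis hU.
have [k sk] : exists k, forall x, x \in s -> C k x.
  have : forall x, x \in s -> U x by move=> x xs; rewrite Us; apply: mem_ideal_gen.
  elim: {Us} s => [|y s IHs] sU; first by exists 0%N.
  have [k sk] : exists k, forall x, x \in s -> C k x.
    by apply: IHs => x xs; apply: sU; rewrite inE xs orbT.
  have [j Cj] := sU y (mem_head _ _).
  exists (maxn k j) => x; rewrite inE => /predU1P[->|xs].
    exact: mono (leq_maxr _ _) _ Cj.
  by apply: mono (leq_maxl _ _) _ _; apply: sk.
exists k => x Cx; have : U x by exists k.+1.
by rewrite Us; apply: ideal_gen_min => //; apply: hC.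
Qed.

(** Without a maximal member above [I], iterated choice would build a strictly ascending sequence of
    ideals. *)
Lemma maximal_ideal_in (F : ({mpoly K[n]} -> Prop) -> Prop) I :
  (forall J, F J -> is_ideal J) -> F I ->
  exists J, [/\ F J, subideal I J & forall J', F J' -> subideal J J' -> J' = J].
Proof.
move=> Fid FI; apply: NNPP => noM.
pose G J := F J /\ subideal I J.
have step J : exists J', G J -> [/\ G J', subideal J J' & ~ subideal J' J].
  case: (classic (G J)) => [GJ|nGJ]; last by exists J.
  apply: NNPP => H; apply: noM; have [FJ IJ] := GJ.
  exists J; split=> // J' FJ' JJ'; apply: NNPP => neq; apply: H.
  exists J' => _; split=> //; first by split=> // x /IJ /JJ'.
  by move=> J'J; apply: neq; apply: same_idealE => x; split; [apply: J'J|apply: JJ'].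
pose next J := proj1_sig (constructive_indefinite_description _ (step J)).
have nextP J : G J -> [/\ G (next J), subideal J (next J) & ~ subideal (next J) J].
  by rewrite /next; case: constructive_indefinite_description.
pose C i := iter i next I.
have GC i : G (C i).
  by elim: i => [|i IHi]; [split | case: (nextP _ IHi)].
have [k] : exists k, subideal (C k.+1) (C k).
  apply: ideal_ascending => i; first by apply: Fid; have [] := GC i.
  by have [_ ? _] := nextP _ (GC i).
by have [_ _] := nextP _ (GC k).
Qed.

(* Maximality of I : xz among the colon ideals missing S makes it prime. *)
Lemma prime_colon_avoiding I (S : {mpoly K[n]} -> Prop) x :
  is_ideal I -> S 1 -> (forall a b, S a -> S b -> S (a * b)) ->
  (forall a, S a -> ~ I (a * x)) ->
  exists z, [/\ associated_prime I (fun y => I (y * (x * z))),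
      forall a, S a -> ~ I (a * (x * z))
    & forall y, I (y * x) -> I (y * (x * z))].
Proof.
move=> hI S1 SM Sx.
pose F J := exists z, J = (fun y => I (y * (x * z))) /\ forall a, S a -> ~ J a.
have Fid J : F J -> is_ideal J by case=> z [-> _]; apply: colon1_is_ideal.
have FI : F (fun y => I (y * x)) by exists 1; rewrite mulr1; split.
have [J [[z [Jz SJ]] IJ maxJ]] := maximal_ideal_in Fid FI.
exists z; split; last by rewrite Jz in IJ.
  rewrite -Jz; split; last by exists (x * z) => y; rewrite Jz.
  split; first by apply: Fid; exists z.
    by apply: SJ.
  move=> b c Jbc; apply: NNPP => /not_or_and [nJb nJc].
  (* Otherwise [I : xzb] avoids [S] and contains [J], so it equals [J] by maximality; but it
     contains [c]. *)
  have [s [Ss Is]] : exists s, S s /\ I (s * (x * (z * b))).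
    apply: NNPP => nos; apply: nJc.
    have <- : (fun y => I (y * (x * (z * b)))) = J.
      apply: maxJ; first by exists (z * b); split=> // a Sa Ia; apply: nos; exists a.
      by move=> y; rewrite Jz => /(@mem_idealMr _ I b _ hI); congr I; ring.
    by move: Jbc; rewrite Jz; congr I; ring.
  (* Likewise [I : xzs] avoids [S], which is multiplicative, so it equals [J]; and it contains
     [b]. *)
  apply: nJb.
  have <- : (fun y => I (y * (x * (z * s)))) = J.
    apply: maxJ; last first.
      by move=> y; rewrite Jz => /(@mem_idealMr _ I s _ hI); congr I; ring.
    exists (z * s); split=> // a Sa Ia; apply: (SJ (a * s)); first exact: SM.
    by rewrite Jz; move: Ia; congr I; ring.
  by move: Is; congr I; ring.
by rewrite -[forall a, _]/(forall a, S a -> ~ (fun y => I (y * (x * z))) a) -Jz.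
Qed.

End Noetherian.

(** * Ideals with pairwise coprime initial monomials *)

Definition supported n (K : fieldType) (T : {set 'I_n}) (q : {mpoly K[n]}) :=
  forall m, m \in msupp q -> forall i, i \notin T -> m i = 0%N.

Section CoprimeInitials.
Variables (n : nat) (K : fieldType) (ord : rel 'X_{1..n}).
Hypothesis ord_term : term_order ord.
Implicit Types (p q r : {mpoly K[n]}) (s : seq {mpoly K[n]}).
Notation lm := (initial_monomial ord).

Definition coprime_mnmb (m1 m2 : 'X_{1..n}) :=
  [forall i, (m1 i == 0%N) || (m2 i == 0%N)].

Definition standard s (m : 'X_{1..n}) := all (fun p => ~~ (lm p <= m)%MM) s.

Definition coprime_initials s :=
  all (fun p => p != 0) s && pairwise (fun p q => coprime_mnmb (lm p) (lm q)) s.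

(** Only the initial monomial of the remainder is made standard; its lower terms may still be
    reducible, which suffices since later arguments look at [lm r] alone. *)
Lemma normal_form s c : all (fun p => p != 0) s ->
  exists r, ideal_gen s (c - r) /\ (r = 0 \/ standard s (lm r)).
Proof.
move=> s0; move: {2}(lm c) (erefl (lm c)) => m.
elim/(well_founded_ind (ord_wf ord_term)): m c => m IHm c lmc.
have [->|c0] := eqVneq c 0.
  by exists 0; rewrite subr0; split; [apply: mem_ideal0|left].
have [std|] := boolP (standard s (lm c)).
  by exists c; rewrite subrr; split; [apply: mem_ideal0|right].
case/allPn => p ps /negPn pc; have p0 := allP s0 _ ps.
pose q := 'X_[lm c - lm p] * p.
have X0 : 'X_[K, (lm c - lm p)%MM] != 0 by rewrite -msupp_eq0 msuppX.
have q0 : q != 0 by rewrite mulf_neq0.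
have lq : lm q = lm c by rewrite lmM // lmX // submK.
pose d := c - (c@_(lm c) / q@_(lm q)) *: q.
have sq : ideal_gen s (c - d).
  rewrite opprB addrC subrK -mul_mpolyC.
  by do 2!apply: mem_idealMl => //; apply: mem_ideal_gen.
have [d0|] := lm_cancel ord_term c0 q0 (esym lq).
  by exists 0; split; [move: sq; rewrite /d d0|left].
rewrite -/d lmc => dc; have [r [sr rP]] := IHm _ dc _ erefl.
by exists r; split=> //; rewrite -[c](subrK d) -addrA; apply: mem_idealD.
Qed.

Lemma coprime_mnmbP (m1 m2 : 'X_{1..n}) :
  reflect (coprime_mnm m1 m2) (coprime_mnmb m1 m2).
Proof.
apply: (iffP forallP) => H i; have := H i.
  by case/orP => /eqP; [left|right].
by case=> ->; rewrite eqxx ?orbT.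
Qed.

Lemma coprime_mnm_lem (m1 m2 m : 'X_{1..n}) :
  coprime_mnm m1 m2 -> (m1 <= m + m2)%MM -> (m1 <= m)%MM.
Proof.
move=> cop /mnm_lepP le; apply/mnm_lepP => i; have := le i.
by rewrite mnmDE; case: (cop i) => ->; rewrite ?addn0.
Qed.

Lemma coprime_initials_rcons s p :
  coprime_initials (rcons s p) =
  [&& coprime_initials s, p != 0 & all (fun q => coprime_mnmb (lm q) (lm p)) s].
Proof.
rewrite /coprime_initials all_rcons pairwise_rcons.
by case: (p != 0); case: all; case: all; case: pairwise.
Qed.

Lemma standardD s q r p : standard s (lm r) ->
  all (fun q => coprime_mnmb (lm q) (lm p)) s -> standard s (lm r + lm p)%MM.
Proof.
move=> /allP std /allP cop; apply/allP => t ts; apply: contra (std t ts).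
by apply: coprime_mnm_lem; apply/coprime_mnmbP/cop.
Qed.

(* Coprimality makes the S-polynomials reduce to zero: writing an element of
   (s, p) as a + r p with a in (s) and r reduced modulo s, the initial monomials
   of a and r p cannot cancel. *)
Lemma coprime_initials_grobner s f : coprime_initials s ->
  ideal_gen s f -> f != 0 -> ~~ standard s (lm f).
Proof.
elim/last_ind: s f => [|s p IHs] f.
  by move=> _ [c ->]; rewrite big_ord0 eqxx.
rewrite coprime_initials_rcons => /and3P[cs p0 cop].
case/ideal_gen_rcons => a [c [sa ->]] f0.
have s0 : all (fun p => p != 0) s by case/andP: cs.
have [r [sr rP]] := normal_form c s0.
pose b := a + (c - r) * p.
have sb : ideal_gen s b by apply: mem_idealD => //; apply: mem_idealMr.
have fE : a + c * p = b + r * p by rewrite /b -addrA -mulrDl subrK.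
rewrite fE in f0 *.
have std_rcons m : standard (rcons s p) m = ~~ (lm p <= m)%MM && standard s m.
  by rewrite /standard all_rcons.
rewrite std_rcons negb_and negbK.
have [r0|r0] := eqVneq r 0.
  by move: f0; rewrite r0 mul0r addr0 => f0; rewrite IHs ?orbT.
case: rP => [e|rP]; first by rewrite e eqxx in r0.
have lrp : lm (r * p) = (lm r + lm p)%MM by rewrite lmM.
have std_rp : standard s (lm (r * p)) by rewrite lrp; apply: standardD.
have [b0|b0] := eqVneq b 0; first by rewrite b0 add0r lrp lem_addl.
have nlm : lm b != lm (r * p).
  by apply: contraNneq (IHs _ cs sb b0) => ->.
have [_ [->|->]] := lmD ord_term b0 (mulf_neq0 r0 p0) nlm.
  by rewrite IHs ?orbT.
by rewrite lrp lem_addl.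
Qed.

(** Let [r] be the remainder of [x]. If it is nonzero, [lm r + lm p] is still standard for [s] by
    coprimality, so [r * p] cannot lie in [(s)]. *)
Lemma coprime_initials_nzd s p x : coprime_initials (rcons s p) ->
  ideal_gen s (x * p) -> ideal_gen s x.
Proof.
rewrite coprime_initials_rcons => /and3P[cs p0 cop] sxp.
have s0 : all (fun p => p != 0) s by case/andP: cs.
have [r [sr rP]] := normal_form x s0.
have srp : ideal_gen s (r * p).
  have -> : r * p = x * p - (x - r) * p by rewrite -mulrBl opprB addrC subrK.
  by apply: mem_idealB => //; apply: mem_idealMr.
have [r0|r0] := eqVneq r 0; first by rewrite r0 subr0 in sr.
case: rP => [e|rP]; first by rewrite e eqxx in r0.
have := coprime_initials_grobner cs srp (mulf_neq0 r0 p0).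
by rewrite lmM // standardD.
Qed.

Lemma coprime_initials_take s i : coprime_initials s -> coprime_initials (take i s).
Proof.
case/andP => s0 ps; apply/andP; split.
  by apply/allP => p /mem_take; apply: (allP s0).
by apply: subseq_pairwise ps; apply: take_subseq.
Qed.

Lemma coprime_initials_nzd_nth s i x : coprime_initials s -> (i < size s)%N ->
  ideal_gen (take i s) (x * s`_i) -> ideal_gen (take i s) x.
Proof.
move=> cs lt_is; apply: coprime_initials_nzd.
by rewrite -take_nth //; apply: coprime_initials_take.
Qed.

End CoprimeInitials.

(** * Consequences of squarefree initial monomials *)

Section SquarefreeInitials.
Variables (n : nat) (K : fieldType) (ord : rel 'X_{1..n}).
Hypothesis ord_term : term_order ord.
Notation lm := (initial_monomial ord).
Variable s : seq {mpoly K[n]}.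
Hypothesis cs : coprime_initials ord s.
Hypothesis sqfree : forall p, p \in s -> squarefree_mnm (lm p).

Let s0 : all (fun p => p != 0) s. Proof. by case/andP: cs. Qed.

(** A squarefree monomial dividing the square of a monomial divides the monomial, so the square of a
    nonzero remainder again has a standard initial monomial. *)
Lemma squarefree_initials_radical y : ideal_gen s (y * y) -> ideal_gen s y.
Proof.
move=> syy; have [r [sr rP]] := normal_form ord_term y s0.
have srr : ideal_gen s (r * r).
  have -> : r * r = y * y - (y - r) * (y + r) by ring.
  by apply: mem_idealB => //; apply: mem_idealMr.
have [r0|r0] := eqVneq r 0; first by rewrite r0 subr0 in sr.
case: rP => [e|rP]; first by rewrite e eqxx in r0.
have := coprime_initials_grobner ord_term cs srr (mulf_neq0 r0 r0).
case/allPn => p ps /negPn; rewrite lmM // => /mnm_lepP le.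
case/negP: (allP rP p ps); apply/mnm_lepP => i; have := le i.
by rewrite mnmDE; have := sqfree ps i; lia.
Qed.

(* If x reduces to r, each lm p misses lm r at a variable occurring in lm p, as
   lm p is squarefree; discarding one such variable per p, no polynomial q in
   the others can bring q r into the ideal, since lm q + lm r is standard. *)
Lemma squarefree_initials_colon_supported x : ~ ideal_gen s x ->
  exists T : {set 'I_n}, (n <= #|T| + size s)%N /\
    forall q, supported T q -> ideal_gen s (q * x) -> q = 0.
Proof.
move=> nsx; have [r [sr rP]] := normal_form ord_term x s0.
case: rP => [r0|std]; first by rewrite r0 subr0 in sr.
have r0 : r != 0 by apply: contra_notN nsx => /eqP r0; rewrite r0 subr0 in sr.
pose v (p : {mpoly K[n]}) := [pick i | (0 < lm p i)%N && (lm r i == 0%N)].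
have vP p : p \in s -> exists2 i, v p = Some i & (0 < lm p i)%N && (lm r i == 0%N).
  move=> ps; rewrite /v; case: pickP => [i iP|no_i]; first by exists i.
  case/negP: (allP std _ ps); apply/mnm_lepP => i; have := no_i i.
  by have := sqfree ps i; lia.
pose V := pmap v s; exists (~: [set i in V]); split.
  have Vs : (#|[set i in V]| <= size s)%N.
    by rewrite cardsE (leq_trans (card_size _)) // size_pmap count_size.
  have e := cardsC [set i in V]; rewrite card_ord in e.
  by apply: leq_trans (eq_leq (esym e)) _; rewrite addnC leq_add2l.
move=> q Tq sqx; apply/eqP; apply: contraT => q0.
have sqr : ideal_gen s (q * r).
  have -> : q * r = q * x - q * (x - r) by rewrite -mulrBr opprB addrC subrK.
  by apply: mem_idealB => //; apply: mem_idealMl.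
have := coprime_initials_grobner ord_term cs sqr (mulf_neq0 q0 r0).
case/allPn => p ps /negPn; rewrite lmM // => /mnm_lepP.
have [i vi /andP[pi /eqP ri]] := vP p ps => /(_ i).
have iT : i \notin ~: [set i in V].
  by rewrite !inE negbK mem_pmap; apply/mapP; exists p.
have qi : lm q i = 0%N by apply: Tq iT; apply: lm_supp.
by rewrite mnmDE qi ri; lia.
Qed.

End SquarefreeInitials.

(** * Heights of primes in a polynomial ring *)

Definition independent_mod n (K : fieldType) (P : {mpoly K[n]} -> Prop)
    (T : {set 'I_n}) :=
  forall q, supported T q -> P q -> q = 0.

(** * Linear independence modulo an ideal and dimension counts *)

Section Counting.
Variables (n : nat) (K : fieldType).
Notation R := {mpoly K[n]}.
Implicit Types (P Q : R -> Prop) (v w : seq R).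

Definition free_mod P v :=
  forall c : nat -> K, P (\sum_(i < size v) c i *: v`_i) ->
  forall i, (i < size v)%N -> c i = 0.

(** Each exponent is bounded separately, rather than the degree, so that the monomials allowed form
    a box of [(D + 1) ^ n] elements. *)
Definition exponents_le D (q : R) :=
  forall m, m \in msupp q -> forall i, (m i <= D)%N.

Lemma exponents_leM D D' q r :
  exponents_le D q -> exponents_le D' r -> exponents_le (D + D') (q * r).
Proof.
move=> qD rD m /msuppM_le /allpairsP [[a b] /= [aq br ->]] i.
by rewrite mnmDE leq_add ?qD ?rD.
Qed.

Lemma exponents_leW D D' q : (D <= D')%N -> exponents_le D q -> exponents_le D' q.
Proof. by move=> DD' qD m mq i; apply: leq_trans DD'; apply: qD. Qed.

Lemma exponents_le_ex q : exists D, exponents_le D q.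
Proof.
exists (msize q) => m mq i; apply: leq_trans (ltnW (msize_mdeg_lt mq)).
by rewrite mdegE (bigD1 i) //= leq_addr.
Qed.

Lemma exponents_le_seq v : exists D, forall q, q \in v -> exponents_le D q.
Proof.
elim: v => [|q v [D vD]]; first by exists 0%N.
have [D' qD'] := exponents_le_ex q; exists (maxn D D') => r.
rewrite inE => /predU1P[->|/vD]; first exact: exponents_leW (leq_maxr _ _) qD'.
exact: exponents_leW (leq_maxl _ _).
Qed.

(** Modulo [P] a relation only involves [v], as [f] is in [P], so the coefficients of [v] vanish.
    What remains is [f] times a combination of [w], and [f] can be cancelled modulo [Q]. *)
Lemma free_mod_cat P Q f v w :
  is_ideal P -> is_ideal Q -> subideal Q P -> P f ->
  (forall z, Q (f * z) -> Q z) ->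
  free_mod P v -> free_mod Q w -> free_mod Q (v ++ [seq f * x | x <- w]).
Proof.
move=> hP hQ sQP Pf nzd vP wQ c Qc.
pose vw := v ++ [seq f * x | x <- w].
have E : \sum_(i < size vw) c i *: vw`_i =
    \sum_(i < size v) c i *: v`_i + f * \sum_(i < size w) c (size v + i)%N *: w`_i.
  rewrite /vw size_cat size_map big_split_ord /=; congr (_ + _).
    by apply: eq_bigr => i _; rewrite nth_cat ltn_ord.
  rewrite mulr_sumr; apply: eq_bigr => i _.
  by rewrite nth_cat ltnNge leq_addr /= addKn (nth_map 0) // scalerAr.
rewrite E {E} in Qc; set A := \sum_(i < size v) _ in Qc.
have PA : P A.
  rewrite -[A](addrK (f * \sum_(i < size w) c (size v + i)%N *: w`_i)).
  by apply: mem_idealB => //; [apply: sQP|apply: mem_idealMr].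
have c0 := vP c PA.
have A0 : A = 0 by rewrite /A big1 // => i _; rewrite c0 ?scale0r.
rewrite A0 add0r in Qc; have c1 := wQ (fun i => c (size v + i)%N) (nzd _ Qc).
move=> i; rewrite size_cat size_map; have [/c0 //|le_vi] := ltnP i (size v).
by rewrite -(subnKC le_vi) ltn_add2l; apply: c1.
Qed.

(** The products [f ^ j * x] with [j <= E] and [x] in [v], generated by a Horner scheme. *)
Definition multiples E f v := iter E (fun w => v ++ [seq f * x | x <- w]) v.

Lemma size_multiples E f v : size (multiples E f v) = (E.+1 * size v)%N.
Proof.
elim: E => [|E IHE]; first by rewrite mul1n.
by rewrite /multiples iterS size_cat size_map [size (iter _ _ _)]IHE.
Qed.

Lemma free_mod_multiples P Q f v E :
  is_ideal P -> is_ideal Q -> subideal Q P -> P f ->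
  (forall z, Q (f * z) -> Q z) ->
  free_mod P v -> free_mod Q (multiples E f v).
Proof.
move=> hP hQ sQP Pf nzd vP; elim: E => [|E IHE].
  by move=> c /sQP; apply: vP.
by rewrite /multiples iterS; apply: (free_mod_cat (P := P)).
Qed.

Lemma exponents_le_multiples D d E f v :
  exponents_le d f -> (forall q, q \in v -> exponents_le D q) ->
  forall q, q \in multiples E f v -> exponents_le (D + E * d) q.
Proof.
move=> fd vD; elim: E => [|E IHE] q; first by rewrite addn0; apply: vD.
rewrite /multiples iterS mem_cat => /orP[/vD|/mapP[x xw ->]].
  by apply: exponents_leW; apply: leq_addr.
rewrite mulSn addnCA; apply: exponents_leM => //; exact: IHE.
Qed.

(** Independence modulo [P] implies independence in the polynomial ring, so the coefficient matrix
    over the box of monomials has independent rows. *)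
Lemma free_mod_size P D v : P 0 -> free_mod P v ->
  (forall q, q \in v -> exponents_le D q) -> (size v <= D.+1 ^ n)%N.
Proof.
move=> P0 vP vD; pose F := {ffun 'I_n -> 'I_D.+1}.
pose mon (f : F) : 'X_{1..n} := [multinom (f i : nat) | i < n].
pose M : 'M[K]_(size v, #|F|) := \matrix_(i, j) (v`_i)@_(mon (enum_val j)).
have Mfree : row_free M.
  rewrite -kermx_eq0; apply/rowV0P => u /sub_kermxP uM.
  pose c i := if insub i is Some j then u 0 j else 0.
  have cE (i : 'I_(size v)) : c i = u 0 i by rewrite /c valK.
  have sum0 : \sum_(i < size v) c i *: v`_i = 0.
    apply/mpolyP => m; rewrite mcoeff0 raddf_sum /=.
    case: (boolP [forall i, m i < D.+1]%N) => [/forallP mD|]; last first.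
      case/forallPn => i nmD; rewrite big1 // => j _; rewrite mcoeffZ.
      rewrite [_@__]memN_msupp_eq0 ?mulr0 //; apply: contra nmD => mj.
      by rewrite ltnS; apply: vD mj _; apply: mem_nth.
    have [f fm] : exists f : F, mon f = m.
      exists [ffun i => Ordinal (mD i)]; apply/mnmP => i.
      by rewrite mnmE ffunE.
    have := congr1 (fun A : 'rV_#|F| => A 0 (enum_rank f)) uM.
    rewrite mxE [X in _ = X]mxE => uM0; rewrite -[RHS]uM0; apply: eq_bigr => i _.
    by rewrite mxE enum_rankK fm mcoeffZ cE.
  apply/rowP => i; rewrite mxE -cE; apply: vP => //.
  by rewrite sum0.
have := rank_leq_col M; rewrite (eqP Mfree).
by rewrite card_ffun !card_ord.
Qed.

Lemma free_mod_monomials P (T : {set 'I_n}) E : independent_mod P T ->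
  exists v, [/\ free_mod P v, size v = (E.+1 ^ #|T|)%N
              & forall q, q \in v -> exponents_le E q].
Proof.
move=> PT; pose F := {ffun 'I_n -> 'I_E.+1}.
pose mon (f : F) : 'X_{1..n} := [multinom (f i : nat) | i < n].
have mon_inj : injective mon.
  move=> f g e; apply/ffunP => i; apply: val_inj.
  by have := congr1 (fun m : 'X_{1..n} => m i) e; rewrite !mnmE.
(* The exponent vectors at most [E] that vanish outside [T]; there are [(E + 1) ^ #|T|] of them. *)
pose s := enum [pred f : F | f \in pffun_on ord0 (mem T) predT].
have sT f : f \in s -> forall i, i \notin T -> mon f i = 0%N.
  rewrite mem_enum => /pffun_onP[/subsetP supp _] i iT; rewrite mnmE.
  by apply/eqP; apply: contraNT iT => fi; apply: supp; rewrite inE -val_eqE.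
have us : uniq [seq mon f | f <- s] by rewrite map_inj_uniq // enum_uniq.
exists [seq 'X_[mon f] | f <- s]; split.
- move=> c; rewrite size_map => Pc.
  have E1 : \sum_(i < size s) c i *: [seq 'X_[mon f] | f <- s]`_i =
     \sum_(i < size s) c i *: 'X_[K, nth 0%MM [seq mon f | f <- s] i].
    apply: eq_bigr => i _; rewrite (map_comp (fun m => 'X_[m]) mon).
    by rewrite (nth_map 0%MM) // size_map.
  rewrite E1 {E1} in Pc => i lt_is.
  set q := \sum_(_ < _) _ in Pc.
  have Tq : supported T q.
    move=> m /msupp_sum_le /flattenP [_ /mapP[j _ ->] /msuppZ_le].
    rewrite msuppX inE => /eqP -> k kT.
    by rewrite (nth_map [ffun=> ord0]) // sT // mem_nth.
  have /(congr1 (fun q => q@_(nth 0%MM [seq mon f | f <- s] i))) := PT _ Tq Pc.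
  rewrite mcoeff0 raddf_sum (bigD1 (Ordinal lt_is)) //= mcoeffZ mcoeffX eqxx mulr1.
  rewrite big1 ?addr0 // => j; rewrite -val_eqE /= => ji; rewrite mcoeffZ mcoeffX.
  by rewrite nth_uniq ?size_map // (negPf ji) mulr0.
- by rewrite size_map -cardE card_pffun_on card_ord.
- move=> _ /mapP[f _ ->] m; rewrite msuppX inE => /eqP -> i.
  by rewrite mnmE -ltnS ltn_ord.
Qed.

(* Monomials in T times products of powers of the f_i, with exponents at most
   E, are linearly independent: there are (E+1)^(|T|+k) of them in a space of
   dimension O(E^n). *)
Lemma independent_chain_bound (Q : nat -> R -> Prop) (f : nat -> R) k
    (T : {set 'I_n}) :
  (forall i, (i <= k)%N -> is_ideal (Q i)) ->
  (forall i, (i < k)%N -> [/\ subideal (Q i) (Q i.+1), Q i.+1 (f i)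
     & forall z, Q i (f i * z) -> Q i z]) ->
  independent_mod (Q k) T -> (#|T| + k <= n)%N.
Proof.
move=> hQ fQ QT.
have [d fd] : exists d, forall i, (i < k)%N -> exponents_le d (f i).
  have [d fd] := exponents_le_seq (mkseq f k); exists d => i ik.
  by apply: fd; rewrite -(nth_mkseq 0 f ik) mem_nth ?size_mkseq.
have H E : ((E.+1 ^ (#|T| + k)) <= ((1 + k * d) * E.+1) ^ n)%N.
  suff [v [vQ sv vD]] : exists v, [/\ free_mod (Q 0%N) v,
       size v = (E.+1 ^ (#|T| + k))%N
       & forall q, q \in v -> exponents_le ((1 + k * d) * E) q].
    rewrite -sv; apply: leq_trans (free_mod_size _ vQ vD) _.
      by apply: mem_ideal0; apply: hQ; apply: leq0n.
    have leD : (((1 + k * d) * E).+1 <= (1 + k * d) * E.+1)%N by lia.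
    by elim: n => [|e IHe]; rewrite ?expn0 // !expnS leq_mul.
  (* Descent from [Q k] to [Q 0]: each step multiplies the size by [E + 1], through the powers of
     one [f i], and adds [E * d] to the exponents. *)
  suff: forall j, (j <= k)%N -> exists v, [/\ free_mod (Q (k - j)%N) v,
       size v = (E.+1 ^ (#|T| + j))%N
       & forall q, q \in v -> exponents_le ((1 + j * d) * E) q].
    by move/(_ _ (leqnn k)); rewrite subnn.
  elim=> [|j IHj] jk.
    rewrite subn0; have [v [v1 v2 v3]] := free_mod_monomials E QT.
    by exists v; split=> //; rewrite ?addn0 // mul1n.
  have [v [vQ sv vD]] := IHj (ltnW jk).
  have kj : (k - j = (k - j.+1).+1)%N by lia.
  have [sQ Qf nzd] : [/\ subideal (Q (k - j.+1)%N) (Q (k - j)%N),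
     Q (k - j)%N (f (k - j.+1)%N)
     & forall z, Q (k - j.+1)%N (f (k - j.+1)%N * z) -> Q (k - j.+1)%N z].
    by rewrite kj; apply: fQ; lia.
  exists (multiples E (f (k - j.+1)%N) v); split.
  - by apply: (free_mod_multiples (P := Q (k - j)%N)) => //; apply: hQ; lia.
  - by rewrite size_multiples sv addnS expnS.
  - have -> : ((1 + j.+1 * d) * E = (1 + j * d) * E + E * d)%N by lia.
    by apply: exponents_le_multiples => //; apply: fd; lia.
rewrite leqNgt; apply/negP => lt_n.
(* If [#|T| + k > n], then [H E] forces [E + 1 <= c ^ n]; the choice [E = c ^ n] refutes this. *)
pose c := (1 + k * d)%N; have := H (c ^ n)%N; rewrite -/c.
apply/negP; rewrite -ltnNge expnMn.
apply: (@leq_trans ((c ^ n).+1 * (c ^ n).+1 ^ n)%N).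
  by rewrite ltn_pmul2r // expn_gt0.
by rewrite -expnS leq_exp2l // ltnS expn_gt0.
Qed.

(** Modulo a prime every element outside it is a nonzerodivisor, so any element of [C i.+1] missing
    from [C i] can serve as [f i]. *)
Lemma prime_chain_bound P (T : {set 'I_n}) h :
  independent_mod P T -> prime_chain P h -> (#|T| + h <= n)%N.
Proof.
move=> PT [C [pC sC /same_idealE Ch]].
have ex_f i : exists f, (i < h)%N -> C i.+1 f /\ ~ C i f.
  case: (ltnP i h) => [ih|]; last by exists 0.
  have [_ nsub] := sC i ih; apply: NNPP => nof; apply: nsub => f Cf.
  by apply: NNPP => nCf; apply: nof; exists f.
pose f i := proj1_sig (constructive_indefinite_description _ (ex_f i)).
have fP i : (i < h)%N -> C i.+1 (f i) /\ ~ C i (f i).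
  by rewrite /f; case: constructive_indefinite_description.
apply: (@independent_chain_bound C f); rewrite ?Ch //.
  by move=> i /pC [].
move=> i ih; have [Cf nCf] := fP i ih; have [sCi _] := sC i ih; split=> // z.
by have [_ _ prC] := pC i (ltnW ih); case/prC.
Qed.

End Counting.

(** * Extension of a prime to a polynomial ring *)

Definition asbool (P : Prop) : bool :=
  if excluded_middle_informative P then true else false.

Lemma asboolP P : reflect P (asbool P).
Proof. by rewrite /asbool; case: excluded_middle_informative => h; constructor. Qed.

Section CoefficientwisePrime.
Variables (A : comNzRingType) (k : nat).
Implicit Types (P : A -> Prop) (F G : {mpoly A[k]}).

(** For an ideal [P] this is its extension to the polynomial ring over [A]. *)
Definition coefwise P F := forall w, P F@_w.

Lemma coefwise_is_ideal P : is_ideal P -> is_ideal (coefwise P).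
Proof.
move=> hP; split=> [w|F G H PG PH w]; first by rewrite mcoeff0; apply: mem_ideal0.
rewrite mcoeffD mcoeffM; apply: mem_idealD => //; apply: mem_ideal_sum => // -[a b] _.
exact: mem_idealMl.
Qed.

Lemma coefwise_reduce P F : is_ideal P -> exists F1, coefwise P (F - F1) /\
  forall w, w \in msupp F1 -> ~ P F1@_w.
Proof.
move=> hP; pose b w := ~~ asbool (P F@_w).
pose F1 := \sum_(w <- msupp F | b w) F@_w *: 'X_[w].
have F1E w : F1@_w = if b w then F@_w else 0.
  rewrite raddf_sum /=; under eq_bigr => i _ do rewrite mcoeffZ mcoeffX.
  have [ws|ws] := boolP (w \in msupp F); last first.
    rewrite (memN_msupp_eq0 ws) if_same big1_seq // => i /andP[_ iF].
    have [e|_] := eqVneq i w; last by rewrite mulr0.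
    by rewrite e in iF; rewrite iF in ws.
  rewrite -big_filter; case: ifP => bw.
    rewrite (bigD1_seq w) ?filter_uniq ?msupp_uniq ?mem_filter ?bw //= eqxx mulr1.
    by rewrite big1 ?addr0 // => i /negPf ->; rewrite mulr0.
  rewrite big1_seq // => i; rewrite mem_filter => /andP[_ /andP[bi _]].
  have [e|_] := eqVneq i w; last by rewrite mulr0.
  by rewrite e bw in bi.
exists F1; split=> w.
  rewrite mcoeffB F1E /b; case: asboolP => /= h; rewrite ?subr0 ?subrr //.
  exact: mem_ideal0.
rewrite mcoeff_msupp F1E /b; case: asboolP => //=.
by rewrite eqxx.
Qed.

(** Once the terms with coefficients in [P] are discarded, both leading coefficients lie outside
    [P], and their product is a coefficient of the product. *)
Lemma coefwise_prime P : prime_ideal P -> prime_ideal (coefwise P).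
Proof.
move=> [hP nP1 prP]; have hcP := coefwise_is_ideal hP; split=> //.
  by move=> P1; apply: nP1; move: (P1 0%MM); rewrite mcoeff1 eqxx.
move=> F G PFG; apply: NNPP => /not_or_and [nPF nPG].
have [F1 [PF1 F1s]] := coefwise_reduce F hP.
have [G1 [PG1 G1s]] := coefwise_reduce G hP.
have F10 : F1 != 0 by apply: contra_notN nPF => /eqP F10; rewrite F10 subr0 in PF1.
have G10 : G1 != 0 by apply: contra_notN nPG => /eqP G10; rewrite G10 subr0 in PG1.
have PFG1 : coefwise P (F1 * G1).
  have -> : F1 * G1 = F * G - ((F - F1) * G + F1 * (G - G1)) by ring.
  apply: (mem_idealB hcP) => //; apply: (mem_idealD hcP); last first.
    exact: (mem_idealMl _ hcP).
  exact: (mem_idealMr _ hcP).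
have := PFG1 (mlead F1 + mlead G1)%MM; rewrite mleadcM => /prP [].
  by apply: F1s; apply: mlead_supp.
by apply: G1s; apply: mlead_supp.
Qed.

End CoefficientwisePrime.

Lemma preimage_prime (A B : comNzRingType) (phi : {rmorphism A -> B}) (P : B -> Prop) :
  prime_ideal P -> prime_ideal (fun x => P (phi x)).
Proof.
case=> hP nP1 prP; split.
- split=> [|a x y Px Py]; first by rewrite rmorph0; apply: mem_ideal0.
  by rewrite rmorphD rmorphM; apply: mem_idealD => //; apply: mem_idealMl.
- by rewrite /is_proper rmorph1.
- by move=> x y; rewrite rmorphM; apply: prP.
Qed.

(** * Contraction to subsets of the variables and the height formula *)

Section VariableSplit.
Variables (n : nat) (K : fieldType).
Notation R := {mpoly K[n]}.
Implicit Types (P : R -> Prop) (U : {set 'I_n}) (p q : R).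

Definition restrict_mnm U (m : 'X_{1..n}) : 'X_{1..n} :=
  [multinom (if i \in U then m i else 0%N) | i < n].

(* p as a polynomial in the variables outside U with coefficients in K[U]. *)
Definition split_at U : R -> {mpoly R[n]} :=
  mmap (@mpolyC n R \o @mpolyC n K)
    (fun i => if i \in U then ('X_i)%:MP else 'X_i).

HB.instance Definition _ U := GRing.RMorphism.copy (split_at U)
  (mmap (@mpolyC n R \o @mpolyC n K)
    (fun i => if i \in U then ('X_i)%:MP else 'X_i)).

Lemma split_atE U p : split_at U p =
  \sum_(m <- msupp p) (p@_m *: 'X_[restrict_mnm U m]) *: 'X_[restrict_mnm (~: U) m].
Proof.
rewrite /split_at /mmap; apply: eq_bigr => m _ /=.
have -> : mmap1 (fun i => if i \in U then ('X_i)%:MP else 'X_i) m =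
   ('X_[K, restrict_mnm U m])%:MP * 'X_[R, restrict_mnm (~: U) m].
  rewrite !mpolyXE_id /mmap1 rmorph_prod -big_split /=; apply: eq_bigr => i _.
  rewrite rmorphXn /= !mnmE inE; case: (i \in U) => /=.
    by rewrite expr0 mulr1.
  by rewrite expr0 mul1r.
by rewrite mulrA -mpolyCM !mul_mpolyC.
Qed.

Lemma mcoeff_split_at U p w : (split_at U p)@_w =
  \sum_(m <- msupp p | restrict_mnm (~: U) m == w) p@_m *: 'X_[restrict_mnm U m].
Proof.
rewrite split_atE raddf_sum [RHS]big_mkcond /=; apply: eq_bigr => m _.
by rewrite mcoeffZ mcoeffX; case: eqP; rewrite ?mulr1 ?mulr0.
Qed.

Lemma split_at_supported T U p w :
  supported T p -> supported (T :&: U) (split_at U p)@_w.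
Proof.
move=> Tp m; rewrite mcoeff_split_at -big_filter => /msupp_sum_le.
case/flattenP => _ /mapP[m' m'p ->] /msuppZ_le.
rewrite msuppX inE => /eqP -> i; rewrite inE mnmE.
move: m'p; rewrite filter_predT mem_filter => /andP[_ m'p].
by rewrite negb_and; case: (i \in U) => //=; rewrite orbF; apply: Tp.
Qed.

Lemma split_at_in U p : supported U p -> split_at U p = p%:MP.
Proof.
move=> Up; rewrite split_atE [in RHS](mpolyE p) raddf_sum /= !big_seq.
apply: eq_bigr => m mp.
have -> : restrict_mnm U m = m.
  by apply/mnmP => i; rewrite mnmE; case: ifP => // /negbT /(Up _ mp) ->.
have -> : restrict_mnm (~: U) m = 0%MM.
  apply/mnmP => i; rewrite mnmE mnm0E inE.
  by case: ifP => // /(Up _ mp) ->.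
by rewrite mpolyX0 alg_mpolyC.
Qed.

Lemma supported_split_at_coef U p w : supported U (split_at U p)@_w.
Proof.
have := @split_at_supported setT U p w; rewrite setTI; apply.
by move=> m _ i; rewrite inE.
Qed.

Lemma split_atK U p : \sum_(w <- msupp (split_at U p)) (split_at U p)@_w * 'X_[w] = p.
Proof.
have -> : \sum_(w <- msupp (split_at U p)) (split_at U p)@_w * 'X_[w] =
    mmap idfun (fun i => 'X_i) (split_at U p).
  by apply: eq_bigr => w _; rewrite mmap1_id.
rewrite split_atE raddf_sum [RHS]mpolyE; apply: eq_bigr => m _ /=.
rewrite mmapZ mmapX /= mmap1_id -scalerAl -mpolyXD; congr (_ *: 'X_[_]).
apply/mnmP => i; rewrite mnmDE !mnmE inE; case: (i \in U) => /=; by rewrite ?addn0.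
Qed.

(* The extension to K[x] of the contraction of P to K[U]. *)
Definition contract_extend P U p := coefwise P (split_at U p).

Lemma contract_extend_prime P U : prime_ideal P -> prime_ideal (contract_extend P U).
Proof. by move=> pP; apply: preimage_prime; apply: coefwise_prime. Qed.

Lemma contract_extend_in P U p : is_ideal P ->
  supported U p -> contract_extend P U p <-> P p.
Proof.
move=> hP Up; rewrite /contract_extend split_at_in //; split=> [Pp|Pp w].
  by have := Pp 0%MM; rewrite mcoeffC eqxx mulr1.
by rewrite mcoeffC; apply: mem_idealMr.
Qed.

Lemma contract_extend_le P U U' : is_ideal P -> is_ideal (contract_extend P U') ->
  U \subset U' -> subideal (contract_extend P U) (contract_extend P U').
Proof.
move=> hP hP' /subsetP UU' p Pp; rewrite -(split_atK U p).
apply: (mem_ideal_sum _ hP') => w _; apply: (mem_idealMr _ hP').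
apply/(contract_extend_in hP); last exact: Pp.
move=> m mw i /(contra (UU' i)); exact: (supported_split_at_coef mw).
Qed.

Lemma contract_extend_setT P : is_ideal P -> contract_extend P setT = P.
Proof.
move=> hP; apply: same_idealE => p; apply: contract_extend_in => //.
by move=> m _ i; rewrite inE.
Qed.

(* Adjoining the variables one at a time, either the contraction of P jumps,
   which lengthens the chain, or the new variable is free modulo P. *)
Lemma prime_chain_exists P : prime_ideal P -> exists (T : {set 'I_n}) h,
  [/\ independent_mod P T, prime_chain P h & (n <= #|T| + h)%N].
Proof.
move=> pP; have hP : is_ideal P by case: pP.
pose U i : {set 'I_n} := [set j : 'I_n | (j < i)%N].
suff H i : (i <= n)%N -> exists (T : {set 'I_n}) h,
    [/\ T \subset U i, independent_mod P T,
        prime_chain (contract_extend P (U i)) h & (i <= #|T| + h)%N].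
  have [T [h [_ PT cP le]]] := H n (leqnn n); exists T, h; split=> //.
  have UT : U n = setT by apply/setP => j; rewrite !inE ltn_ord.
  by rewrite UT contract_extend_setT in cP.
elim: i => [_|i IHi lt_in].
  exists set0, 0%N; split; rewrite ?sub0set //; last first.
    by apply: prime_chain0; apply: contract_extend_prime.
  (* A polynomial supported on no variable is constant, and a proper ideal contains no nonzero
     constant. *)
  move=> q q0 Pq; have qC : q = (q@_0)%:MP.
    apply/mpolyP => m; rewrite mcoeffC;
    have [<-|m0] := eqVneq 0%MM m; rewrite ?mulr1 //.
    rewrite mulr0; apply/eqP; rewrite mcoeff_eq0; apply: contra m0 => mq.
    by apply/eqP/mnmP => j; rewrite mnm0E (q0 _ mq) // inE.
  have [q00|q00] := eqVneq q@_0 0; first by rewrite qC q00 mpolyC0.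
  case: pP => _ nP1 _; case: nP1.
  by rewrite -mpolyC1 -(mulVf q00) mpolyCM -qC; apply: mem_idealMl.
have [T [h [sT PT cP le]]] := IHi (ltnW lt_in).
have sU : U i \subset U i.+1 by apply/subsetP => j; rewrite !inE => /leqW.
have pP' := contract_extend_prime (U i.+1) pP.
have sP : subideal (contract_extend P (U i)) (contract_extend P (U i.+1)).
  by have [hP' _ _] := pP'; apply: contract_extend_le hP hP' sU.
case: (classic (subideal (contract_extend P (U i.+1))
                         (contract_extend P (U i)))); last first.
  move=> nsP; exists T, h.+1; split; [exact: subset_trans sU|exact: PT| |].
    exact: prime_chain_rcons pP' cP sP nsP.
  by rewrite addnS ltnS.
move=> sP'; have eP : contract_extend P (U i.+1) = contract_extend P (U i).
  by apply: same_idealE => x; split; [apply: sP'|apply: sP].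
pose j := Ordinal lt_in; have jT : j \notin T.
  by apply: contraT => /negbNE /(subsetP sT); rewrite inE ltnn.
have sjT : j |: T \subset U i.+1.
  by rewrite subUset (subset_trans sT sU) andbT sub1set inE.
exists (j |: T), h; rewrite eP; split; [exact: sjT| |exact: cP|]; last first.
  by rewrite cardsU1 jT addSn ltnS.
move=> q Tq Pq.
have Uq : supported (U i.+1) q.
  by move=> m mq k; move/(contra (subsetP sjT k)); apply: Tq mq _.
(* As the two contractions extend to the same ideal, the coefficients of [q] in powers of the new
   variable lie in [P]; they also lie in [K[T]], hence vanish. *)
have Pq' : contract_extend P (U i) q.
  by rewrite -eP; apply/contract_extend_in.
suff s0 : split_at (U i) q = 0 by rewrite -(split_atK (U i) q) s0 msupp0 big_nil.
apply/mpolyP => w; rewrite mcoeff0; apply: PT (Pq' w) => m mw k kT.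
apply: (split_at_supported Tq mw); apply: contra kT; rewrite !inE.
by case/andP => /predU1P[->|//]; rewrite ltnn.
Qed.

(** The counting bound and the constructed chain meet. This is the formula [ht P + dim R/P = n],
    with the dimension realized by a set of variables; in particular every prime has a height. *)
Lemma prime_height_ex P : prime_ideal P -> exists h (T : {set 'I_n}),
  [/\ prime_height P h, independent_mod P T & (#|T| + h = n)%N].
Proof.
move=> pP; have [T [h [PT cP le]]] := prime_chain_exists pP.
have e : (#|T| + h = n)%N by apply/eqP; rewrite eqn_leq le (prime_chain_bound PT).
exists h, T; split=> //; split=> // k /(prime_chain_bound PT) le_k.
by rewrite -(leq_add2l #|T|) e.
Qed.

Lemma prime_height_independent P h (T : {set 'I_n}) :
  prime_height P h -> independent_mod P T -> (#|T| + h <= n)%N.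
Proof. by case=> _ cP _ PT; apply: prime_chain_bound cP. Qed.

Lemma prime_height_le P Q h k :
  prime_height P h -> prime_height Q k -> subideal P Q -> (h <= k)%N.
Proof.
move=> [_ cP _] [pQ _ mQ] sPQ.
by have [l hl /mQ] := prime_chain_le pQ cP sPQ; apply: leq_trans.
Qed.

Lemma prime_height_eq P Q h :
  prime_height P h -> prime_height Q h -> subideal P Q -> P = Q.
Proof.
move=> [_ cP _] [pQ _ mQ] sPQ; apply: NNPP => nPQ.
have nQP : ~ subideal Q P.
  by move=> sQP; apply: nPQ; apply: same_idealE => x; split; [apply: sPQ|apply: sQP].
by have := mQ _ (prime_chain_rcons pQ cP sPQ nQP); rewrite ltnn.
Qed.

End VariableSplit.

(** * Colon ideals of squarefree initial sequences *)

Section SquarefreeColon.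
Variables (n : nat) (K : fieldType) (ord : rel 'X_{1..n}).
Notation R := {mpoly K[n]}.
Hypothesis ord_term : term_order ord.
Variable s : seq R.
Hypothesis cs : coprime_initials ord s.
Hypothesis sqfree : forall p, p \in s -> squarefree_mnm (initial_monomial ord p).
Implicit Types (I J P : R -> Prop).

Let hs : is_ideal (ideal_gen s). Proof. exact: ideal_gen_is_ideal. Qed.

(** Here the chain counted is that of the prefix ideals of [s], each [s_i] being a nonzerodivisor
    modulo the preceding ones. It gives [#|T| + size s <= n] for a [T] independent modulo [P] with
    [#|T| + ht P = n]. *)
Lemma squarefree_initials_height_ge P k :
  subideal (ideal_gen s) P -> prime_height P k -> (size s <= k)%N.
Proof.
move=> sP hP; have [pP _ _] := hP.
have [h [T [hPh PT e]]] := prime_height_ex pP.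
rewrite (prime_heightP hP hPh) -(leq_add2l #|T|) e.
apply: (@independent_chain_bound _ _ (fun i => ideal_gen (take i s)) (nth 0 s)).
- by move=> i _; apply: ideal_gen_is_ideal.
- move=> i lt_is; split.
  + apply: ideal_gen_sub => x; rewrite (take_nth 0) // mem_rcons inE => ->.
    by rewrite orbT.
  + apply: mem_ideal_gen; rewrite (take_nth 0) // mem_rcons mem_head //.
  + by move=> z; rewrite mulrC; apply: coprime_initials_nzd_nth cs lt_is.
- by move=> q Tq; rewrite take_size => /sP; apply: PT.
Qed.

(** A prime multiplying some [y] outside [(s)] into [(s)] meets [K[T]] trivially for a large [T],
    which bounds its height by [size s]; containing [(s)] gives the other inequality. *)
Lemma squarefree_initials_height P y :
  prime_ideal P -> subideal (ideal_gen s) P -> ~ ideal_gen s y ->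
  (forall p, P p -> ideal_gen s (p * y)) -> prime_height P (size s).
Proof.
move=> pP sP nsy Py; have [h [T' [hP _ _]]] := prime_height_ex pP.
have [T [le_n Ty]] := squarefree_initials_colon_supported ord_term cs sqfree nsy.
have PT : independent_mod P T by move=> q Tq /Py; apply: Ty.
have le1 := prime_height_independent hP PT.
have le2 := squarefree_initials_height_ge sP hP.
suff -> : size s = h by [].
by apply/eqP; rewrite eqn_leq le2 -(leq_add2l #|T|) (leq_trans le1).
Qed.

(** If [P = J : x] is an associated prime, then [x] is not in [J], so [x * f] is outside [(s)] for
    some [f] in [I], while [P] multiplies [x * f] into [(s)]. *)
Lemma squarefree_initials_colon I : is_proper (colon (ideal_gen s) I) ->
  unmixed (colon (ideal_gen s) I) /\ ideal_height (colon (ideal_gen s) I) (size s).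
Proof.
set J := colon _ _ => nJ1; have hJ : is_ideal J by apply: colon_is_ideal.
have sJ : subideal (ideal_gen s) J by apply: sub_colon.
have JP P : associated_prime J P -> prime_height P (size s).
  move=> [pP [x Px]].
  have [f If nsf] : exists2 f, I f & ~ ideal_gen s (x * f).
    have [_ nP1 _] := pP; apply: NNPP => H; apply: nP1; apply/Px.
    by rewrite mul1r => f If; apply: NNPP => nsf; apply: H; exists f.
  apply: squarefree_initials_height pP _ nsf _ => p.
    by move=> sp; apply/Px; apply: (mem_idealMr _ hJ); apply: sJ.
  by move/Px => /(_ f If); rewrite mulrA.
split; first by split=> //; exists (size s).
split; last first.
  by move=> P k JsP; apply: squarefree_initials_height_ge => x sx; apply/JsP/sJ.
(* With the multiplicative set [{1}]: the proper ideal [J] has an associated prime, which witnesses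
   that the height is attained. *)
have [z [aP _ sP]] : exists z, [/\ associated_prime J (fun y => J (y * (1 * z))),
      forall a, a = 1 -> ~ J (a * (1 * z))
    & forall y, J (y * 1) -> J (y * (1 * z))].
  apply: prime_colon_avoiding => //; first by move=> a b -> ->; rewrite mulr1.
  by move=> a ->; rewrite mulr1.
exists (fun y => J (y * (1 * z))); split; last exact: JP.
by move=> y Jy; apply: sP; rewrite mulr1.
Qed.

Hypothesis proper_s : is_proper (ideal_gen s).

Lemma squarefree_initials_regular : regular_sequence s.
Proof.
split=> // i lt_is x; exact: coprime_initials_nzd_nth cs lt_is.
Qed.

(** The complement of [P] is multiplicative and misses [I]; an associated prime avoiding it lies
    inside [P]. *)
Lemma prime_height_associated I P h : is_ideal I -> subideal I P -> prime_height P h ->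
  exists2 Q, associated_prime I Q & subideal Q P.
Proof.
move=> hI sIP [[hP nP1 prP] _ _].
have [z [aP nP _]] : exists z, [/\ associated_prime I (fun y => I (y * (1 * z))),
      forall a, ~ P a -> ~ I (a * (1 * z))
    & forall y, I (y * 1) -> I (y * (1 * z))].
  apply: prime_colon_avoiding => //; first by move=> a b na nb /prP [].
  by move=> a na; rewrite mulr1 => /sIP.
exists (fun y => I (y * (1 * z))) => // y Iy.
by apply: NNPP => /nP.
Qed.

(** The common height in [unmixed] is only existentially given. It is at most [g], because a prime
    of height [g] over [I] contains an associated prime, and at least [g] by minimality. *)
Lemma unmixed_associated_height I g P :
  unmixed I -> ideal_height I g -> associated_prime I P -> prime_height P g.
Proof.
move=> [hI _ [h assh]] [[P0 [IP0 hP0]] minh] aP.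
have [Q aQ QP0] := prime_height_associated hI IP0 hP0.
have hQ := assh _ aQ; have hg := prime_height_le hQ hP0 QP0.
have IQ : subideal I Q.
  case: aQ => _ [x Qx] y Iy; apply/Qx; exact: mem_idealMr.
suff -> : g = h by apply: assh.
by apply/eqP; rewrite eqn_leq hg (minh _ _ IQ hQ).
Qed.

(* As (s) is radical, a minimal prime P of (s) containing I is (s) : y with
   y outside P; then y is in (s) : I, and a multiplier x of (s) : I into (s) has
   xy in (s), so x is in P. *)
Lemma squarefree_initials_double_colon I x :
  subideal (ideal_gen s) I -> unmixed I -> ideal_height I (size s) ->
  colon (ideal_gen s) (colon (ideal_gen s) I) x -> I x.
Proof.
move=> sI uI hI Jx; have [idI _ _] := uI; apply: NNPP => nIx.
(* With the multiplicative set [{1}]: an associated prime of [I] that contains [I : x]. *)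
have [z [aP nP sP]] : exists z, [/\ associated_prime I (fun y => I (y * (x * z))),
      forall a, a = 1 -> ~ I (a * (x * z))
    & forall y, I (y * x) -> I (y * (x * z))].
  apply: prime_colon_avoiding => //; first by move=> a b -> ->; rewrite mulr1.
  by move=> a ->; rewrite mul1r.
set P := fun y => _ in aP; have hP := unmixed_associated_height uI hI aP.
have IP : subideal I P by move=> y Iy; apply: mem_idealMr.
have sP' : subideal (ideal_gen s) P by move=> y /sI /IP.
have [Q aQ QP] := prime_height_associated hs sP' hP.
have [pQ [y Qy]] := aQ; have [_ nQ1 prQ] := pQ.
have sQ : subideal (ideal_gen s) Q.
  by move=> p sp; apply/Qy; apply: mem_idealMr.
have nsy : ~ ideal_gen s y by move=> sy; apply: nQ1; apply/Qy; rewrite mul1r.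
have hQ : prime_height Q (size s).
  by apply: squarefree_initials_height pQ sQ nsy _ => p /Qy.
have PQ : P = Q by rewrite (prime_height_eq hQ hP QP).
(* If [y] were in [P = (s) : y], its square would be in [(s)], hence [y] itself by radicality. *)
have nPy : ~ P y.
  rewrite PQ => /Qy syy; apply: nsy.
  exact: (squarefree_initials_radical ord_term cs sqfree syy).
have Jy : colon (ideal_gen s) I y.
  by move=> f /IP; rewrite PQ mulrC => /Qy.
have := Jx y Jy; move/Qy; rewrite -PQ => Px.
(* The product of [x] and [y] lies in [(s)], hence in [I]; so [y] is in [I : x], which is contained
   in [P]. *)
apply: nPy; apply: sP; rewrite mulrC; apply: sI; exact: Jx.
Qed.

Lemma squarefree_initials_linked I :
  subideal (ideal_gen s) I -> unmixed I -> ideal_height I (size s) ->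
  ~ same_ideal I (ideal_gen s) ->
  linked I (colon (ideal_gen s) I) /\ is_proper (colon (ideal_gen s) I).
Proof.
move=> sI uI hI nIs; have [idI nI1 _] := uI.
have pJ : is_proper (colon (ideal_gen s) I).
  move=> J1; apply: nIs => x; split=> [Ix|]; last exact: sI.
  by rewrite -[x]mul1r; apply: J1.
split; last exact: pJ.
split; [by split|by split; [apply: colon_is_ideal|]|].
exists s; split; [exact: squarefree_initials_regular|by []|].
move=> x; split; last exact: squarefree_initials_double_colon.
by move=> Ix y Jy; rewrite mulrC; apply: Jy.
Qed.

End SquarefreeColon.

(** * Homogeneous ideals and sequences as in property P *)

Section Homogeneous.
Variables (n : nat) (K : fieldType) (mf : measure n).
Notation R := {mpoly K[n]}.
Implicit Types (I J : R -> Prop) (p q : R).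

Lemma pihomogM d e p q : q \is e.-homog for mf ->
  pihomog mf (d + e) (p * q) = pihomog mf d p * q.
Proof.
move=> qe; rewrite {1}(pihomog_partitionE (mf := mf) (leqnn (mmeasure mf p))).
rewrite mulr_suml raddf_sum /=.
have H k : pihomog mf (d + e) (pihomog mf k p * q) =
    if k == d then pihomog mf d p * q else 0.
  have hk : pihomog mf k p * q \is (k + e).-homog for mf.
    by apply: dhomogM => //; apply: pihomogP.
  have [->|kd] := eqVneq k d; first by rewrite pihomog_dE // dhomogM // pihomogP.
  by rewrite (pihomog_ne0 (d := k + e)) // eqn_add2r.
under eq_bigr => k _ do rewrite H.
have [lt_d|le_d] := ltnP d (mmeasure mf p).
  rewrite (bigD1 (Ordinal lt_d)) //= eqxx big1 ?addr0 // => k.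
  by rewrite -val_eqE /= => /negPf ->.
rewrite big1 => [|k _].
  have -> : pihomog mf d p = 0; last by rewrite mul0r.
  rewrite pihomogE big1_seq // => m /andP[/eqP md mp]; have := mmeasure_mnm_lt mf mp.
  by rewrite md ltnNge le_d.
by case: eqP => // kd; have := ltn_ord k; rewrite kd ltnNge le_d.
Qed.

Lemma pihomogM_lt d e p q : q \is e.-homog for mf -> (d < e)%N ->
  pihomog mf d (p * q) = 0.
Proof.
move=> qe lt_de; rewrite (pihomog_partitionE (mf := mf) (leqnn (mmeasure mf p))).
rewrite mulr_suml raddf_sum /= big1 // => k _.
have hk : pihomog mf k p * q \is (k + e).-homog for mf.
  by apply: dhomogM => //; apply: pihomogP.
by rewrite (pihomog_ne0 (d := (k + e)%N)) //; lia.
Qed.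

Lemma homogeneous_ideal_gen s : (forall p, p \in s -> p \is homog mf) ->
  homogeneous_ideal mf (ideal_gen s).
Proof.
move=> sh p d [c ->]; rewrite raddf_sum /=; apply: mem_ideal_sum => // i _.
have si : s`_i \in s by apply: mem_nth.
have [e he] : exists e, s`_i \is e.-homog for mf by apply/homogP/sh.
have [lt_de|le_ed] := ltnP d e.
  by rewrite (pihomogM_lt _ he lt_de); apply: mem_ideal0.
rewrite -(subnK le_ed) pihomogM //; apply: mem_idealMl => //.
exact: mem_ideal_gen.
Qed.

(** It suffices to test against the homogeneous components of [y], which stay in [J]; multiplying by
    one of them shifts the components of [x] by its degree. *)
Lemma homogeneous_colon I J : is_ideal I ->
  homogeneous_ideal mf I -> homogeneous_ideal mf J ->
  homogeneous_ideal mf (colon I J).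
Proof.
move=> idI hI hJ x d Jx y Jy.
rewrite (pihomog_partitionE (mf := mf) (leqnn (mmeasure mf y))) mulr_sumr.
apply: (mem_ideal_sum _ idI) => e _.
rewrite -(@pihomogM d e) ?pihomogP //.
by apply: hI; apply: Jx; apply: hJ.
Qed.

Lemma P_sequence_coprime_initials I ord g (alpha : g.-tuple R) :
  P_sequence mf I ord alpha ->
  coprime_initials ord alpha /\
  forall p, p \in (alpha : seq R) -> squarefree_mnm (initial_monomial ord p).
Proof.
move=> [H1 H2 H3]; split; last by move=> p /tnthP [i ->].
apply/andP; split; first by apply/allP => p /tnthP [i ->]; case: (H1 i).
apply/(pairwiseP 0) => i j; rewrite !inE size_tuple => lt_i lt_j ij.
apply/coprime_mnmbP; have := H3 (Ordinal lt_i) (Ordinal lt_j).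
by rewrite !(tnth_nth 0) /=; apply; rewrite -val_eqE /= ltn_eqF.
Qed.

Lemma P_sequence_sub I ord g (alpha : g.-tuple R) :
  is_ideal I -> P_sequence mf I ord alpha -> subideal (ideal_gen alpha) I.
Proof.
move=> hI [H1 _ _]; apply: ideal_gen_min => // p /tnthP [i ->].
by case: (H1 i).
Qed.

Lemma P_sequence_homogeneous I ord g (alpha : g.-tuple R) :
  P_sequence mf I ord alpha -> homogeneous_ideal mf (ideal_gen alpha).
Proof.
move=> [H1 _ _]; apply: homogeneous_ideal_gen => p /tnthP [i ->].
by case: (H1 i).
Qed.

(** The predicate [fun=> True] retains from [P_sequence] what concerns the polynomials alone;
    membership in [J] follows from [a] being contained in [a : I]. Both the link in [R] and the
    generic link are instances. *)
Lemma P_sequence_colon I ord g (alpha : g.-tuple R) (J := colon (ideal_gen alpha) I) :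
  term_order ord -> homogeneous_ideal mf I -> P_sequence mf (fun=> True) ord alpha ->
  is_proper J ->
  [/\ unmixed J, homogeneous_ideal mf J, ideal_height J g & P_sequence mf J ord alpha].
Proof.
move=> ho hI Pa pJ; have [cs sq] := P_sequence_coprime_initials Pa.
have [uJ hJ] := squarefree_initials_colon ho cs sq pJ.
rewrite size_tuple in hJ; split=> //.
  by apply: homogeneous_colon hI => //; apply: P_sequence_homogeneous Pa.
case: Pa => H1 H2 H3; split=> // i; have [_ ? ?] := H1 i; split=> //.
by apply: sub_colon => //; apply: mem_ideal_gen; apply: mem_tnth.
Qed.

End Homogeneous.

(** * Polynomial extensions and stable equivalence *)

Section ExtendIdeal.
Variables (A B : comNzRingType) (phi : {rmorphism A -> B}).
Implicit Types (I : A -> Prop) (J : B -> Prop).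

Lemma extend_ideal_is_ideal I : is_ideal (extend_ideal phi I).
Proof.
split=> [|a x y [s [sI sx]] [t [tI ty]]].
  by exists [::]; split=> //; apply: mem_ideal0.
exists (s ++ t); split=> [z|].
  by rewrite mem_cat => /orP[/sI|/tI].
rewrite map_cat; apply: mem_idealD => //.
  by apply: mem_idealMl => //; apply: ideal_gen_sub sx => z; rewrite mem_cat => ->.
by apply: ideal_gen_sub ty => z; rewrite mem_cat orbC => ->.
Qed.

Lemma mem_extend_ideal I x : I x -> extend_ideal phi I (phi x).
Proof.
move=> Ix; exists [:: x]; split=> [y|]; first by rewrite inE => /eqP ->.
by apply: mem_ideal_gen; rewrite mem_head.
Qed.

Lemma extend_ideal_min I J :
  is_ideal J -> (forall x, I x -> J (phi x)) -> subideal (extend_ideal phi I) J.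
Proof.
move=> hJ IJ y [s [sI]]; apply: ideal_gen_min => // _ /mapP[x xs ->].
exact/IJ/sI.
Qed.

Lemma extend_ideal_gen s :
  extend_ideal phi (ideal_gen s) = ideal_gen [seq phi x | x <- s].
Proof.
apply: same_idealE => y; split.
  apply: extend_ideal_min => // x [c ->]; rewrite rmorph_sum /=.
  apply: mem_ideal_sum => // i _; rewrite rmorphM; apply: mem_idealMl => //.
  by apply: mem_ideal_gen; apply: map_f; apply: mem_nth.
apply: ideal_gen_min; first exact: extend_ideal_is_ideal.
by move=> _ /mapP[x xs ->]; apply: mem_extend_ideal; apply: mem_ideal_gen.
Qed.

End ExtendIdeal.

Lemma extend_ideal_comp (A B C : comNzRingType) (phi : {rmorphism A -> B})
    (psi : {rmorphism B -> C}) (chi : {rmorphism A -> C}) (I : A -> Prop) :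
  (forall x, psi (phi x) = chi x) ->
  extend_ideal psi (extend_ideal phi I) = extend_ideal chi I.
Proof.
move=> E; apply: same_idealE => y; split.
  apply: extend_ideal_min; first exact: extend_ideal_is_ideal.
  move=> x; apply: (@extend_ideal_min _ _ phi I (fun x => extend_ideal chi I (psi x))).
    split=> [|a z t]; first rewrite rmorph0.
      by apply: mem_ideal0; apply: extend_ideal_is_ideal.
    have hE := extend_ideal_is_ideal chi I.
    rewrite rmorphD rmorphM => hz ht; apply: (mem_idealD hE) => //.
    exact: (mem_idealMl _ hE).
  by move=> z Iz; rewrite E; apply: mem_extend_ideal.
apply: extend_ideal_min; first exact: extend_ideal_is_ideal.
by move=> x Ix; rewrite -E; do 2!apply: mem_extend_ideal.
Qed.

Section IsoTransport.
Variables (A B : comNzRingType) (phi : {rmorphism A -> B}) (psi : {rmorphism B -> A}).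
Hypotheses (phiK : cancel phi psi) (psiK : cancel psi phi).
Implicit Types (I P : A -> Prop).

Lemma extend_ideal_iso I : is_ideal I -> extend_ideal phi I = fun y => I (psi y).
Proof.
move=> hI; apply: same_idealE => y; split; last first.
  by move=> Iy; rewrite -[y]psiK; apply: mem_extend_ideal.
apply: (@extend_ideal_min _ _ phi I (fun y => I (psi y))).
  split=> [|a z t Iz It]; first by rewrite rmorph0; apply: mem_ideal0.
  by rewrite rmorphD rmorphM; apply: mem_idealD => //; apply: mem_idealMl.
by move=> x; rewrite phiK.
Qed.

Lemma colon_iso I J : is_ideal I -> is_ideal J ->
  colon (extend_ideal phi I) (extend_ideal phi J) = extend_ideal phi (colon I J).
Proof.
move=> hI hJ; rewrite !extend_ideal_iso //; last exact: colon_is_ideal.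
apply: same_idealE => y; split=> Hy z Jz.
  by rewrite -[z]phiK -rmorphM; apply: Hy; rewrite phiK.
by rewrite rmorphM; apply: Hy.
Qed.

Lemma prime_chain_iso P h : prime_chain P h -> prime_chain (fun y => P (psi y)) h.
Proof.
case=> C [pC sC /same_idealE <-]; exists (fun i y => C i (psi y)); split=> //.
  by move=> i /pC; apply: preimage_prime.
move=> i /sC [s1 ns]; split=> [y|s2]; first exact: s1.
by apply: ns => x Cx; rewrite -[x]phiK; apply: s2; rewrite phiK.
Qed.

End IsoTransport.

Lemma prime_height_iso (A B : comNzRingType) (phi : {rmorphism A -> B})
    (psi : {rmorphism B -> A}) (P : A -> Prop) h :
  cancel phi psi -> cancel psi phi ->
  prime_height P h -> prime_height (fun y => P (psi y)) h.
Proof.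
move=> phiK psiK [pP cP mP]; split; first exact: preimage_prime.
  exact: prime_chain_iso cP.
move=> k /(prime_chain_iso psiK) cP'; apply: mP.
suff -> : P = (fun x => P (psi (phi x))) by [].
by apply: same_idealE => x; rewrite phiK.
Qed.

Lemma ideal_height_iso (A B : comNzRingType) (phi : {rmorphism A -> B})
    (psi : {rmorphism B -> A}) (I : A -> Prop) h :
  cancel phi psi -> cancel psi phi -> is_ideal I ->
  ideal_height I h -> ideal_height (extend_ideal phi I) h.
Proof.
move=> phiK psiK hI [[P [IP hP]] mI]; rewrite (extend_ideal_iso phiK psiK hI).
split.
  exists (fun y => P (psi y)); split=> [y /IP //|].
  exact: prime_height_iso hP.
move=> Q k IQ hQ; apply: (mI (fun x => Q (phi x))); last exact: prime_height_iso hQ.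
by move=> x Ix; apply: IQ; rewrite phiK.
Qed.

(** * Substitution morphisms between polynomial rings *)

Section AlgebraMaps.
Variable K : fieldType.

Definition amap n m (h : 'I_n -> {mpoly K[m]}) : {mpoly K[n]} -> {mpoly K[m]} :=
  mmap (@mpolyC m K) h.

HB.instance Definition _ n m (h : 'I_n -> {mpoly K[m]}) :=
  GRing.RMorphism.copy (amap h) (mmap (@mpolyC m K) h).

Lemma amapX n m (h : 'I_n -> {mpoly K[m]}) i : amap h 'X_i = h i.
Proof. by rewrite /amap mmapX mmap1U. Qed.

Lemma amapC n m (h : 'I_n -> {mpoly K[m]}) c : amap h c%:MP = c%:MP.
Proof. by rewrite /amap mmapC. Qed.

Lemma mpoly_rmorph_eq n (B : comNzRingType) (f g : {rmorphism {mpoly K[n]} -> B}) :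
  (forall c, f c%:MP = g c%:MP) -> (forall i, f 'X_i = g 'X_i) -> f =1 g.
Proof.
move=> fgC fgX p; rewrite [p]mpolyE !rmorph_sum /=; apply: eq_bigr => m _.
rewrite -mul_mpolyC !rmorphM fgC mpolyXE_id !rmorph_prod; congr (_ * _).
by apply: eq_bigr => i _; rewrite !rmorphXn /= fgX.
Qed.

Lemma amap_comp n m l (h : 'I_n -> {mpoly K[m]}) (h' : 'I_m -> {mpoly K[l]}) p :
  amap h' (amap h p) = amap (fun i => amap h' (h i)) p.
Proof.
apply: (mpoly_rmorph_eq (f := amap h' \o amap h)) => [c|i] /=.
  by rewrite !amapC.
by rewrite !amapX.
Qed.

Lemma amap_eq n m (h h' : 'I_n -> {mpoly K[m]}) : h =1 h' -> amap h =1 amap h'.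
Proof.
move=> hh'; apply: mpoly_rmorph_eq => [c|i] /=; first by rewrite !amapC.
by rewrite !amapX.
Qed.

Lemma amap_id n (p : {mpoly K[n]}) : amap (fun i => 'X_i) p = p.
Proof.
by apply: (mpoly_rmorph_eq (g := idfun)) => [c|i] /=; rewrite ?amapC // amapX.
Qed.

Definition inclX n k (i : 'I_n) : {mpoly K[n + k]} := 'X_(lshift k i).

Lemma mpoly_inclE n k : @mpoly_incl K n k = amap (@inclX n k).
Proof.
apply: functional_extensionality => p; rewrite /mpoly_incl /comp_mpoly /amap /mmap.
by apply: eq_bigr => m _; congr (_ * _); apply: mmap1_eq => i; rewrite tnth_mktuple.
Qed.

Lemma mpoly_extE n k (I : {mpoly K[n]} -> Prop) :
  mpoly_ext k I = extend_ideal (amap (@inclX n k)) I.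
Proof. by rewrite /mpoly_ext mpoly_inclE. Qed.

Definition fsum n k (X : Type) (f : 'I_n -> X) (g : 'I_k -> X) (i : 'I_(n + k)) : X :=
  match split i with inl j => f j | inr j => g j end.

Lemma fsuml n k X (f : 'I_n -> X) (g : 'I_k -> X) i : fsum f g (lshift k i) = f i.
Proof. by rewrite /fsum -[lshift k i]/(unsplit (inl i)) unsplitK. Qed.

Lemma fsumr n k X (f : 'I_n -> X) (g : 'I_k -> X) i : fsum f g (rshift n i) = g i.
Proof. by rewrite /fsum -[rshift n i]/(unsplit (inr i)) unsplitK. Qed.

End AlgebraMaps.
Definition fsumE := (fsuml, fsumr).

(** * Ideals and heights after adjoining variables *)

Section ExtensionByVariables.
Variables (n k : nat) (K : fieldType).
Notation R := {mpoly K[n]}.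
Notation RY := {mpoly K[n + k]}.
Implicit Types (I J P : R -> Prop) (p : RY).

(** Reading an element as a polynomial in the new variables over [R] turns membership in an extended
    ideal into a condition on coefficients. *)
Definition as_poly_in_Y : RY -> {mpoly R[k]} :=
  mmap (@mpolyC k R \o @mpolyC n K)
    (fsum (fun i => ('X_i)%:MP) (fun j => 'X_j)).

HB.instance Definition _ := GRing.RMorphism.copy as_poly_in_Y
  (mmap (@mpolyC k R \o @mpolyC n K)
    (fsum (fun i => ('X_i)%:MP) (fun j => 'X_j))).

Notation incl := (amap (@inclX K n k)).

Definition of_poly_in_Y : {mpoly R[k]} -> RY :=
  mmap (incl : {rmorphism R -> RY}) (fun j => 'X_(rshift n j)).

HB.instance Definition _ := GRing.RMorphism.copy of_poly_in_Y
  (mmap (incl : {rmorphism R -> RY}) (fun j => 'X_(rshift n j))).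

Lemma as_poly_in_Y_incl (q : R) : as_poly_in_Y (incl q) = q%:MP.
Proof.
apply: (mpoly_rmorph_eq (f := as_poly_in_Y \o incl) (g := @mpolyC k R)) => [c|i] /=.
  by rewrite amapC /as_poly_in_Y mmapC.
by rewrite amapX /as_poly_in_Y mmapX mmap1U fsumE.
Qed.

Lemma as_poly_in_YK p : of_poly_in_Y (as_poly_in_Y p) = p.
Proof.
apply: (mpoly_rmorph_eq (f := of_poly_in_Y \o as_poly_in_Y) (g := idfun)) => [c|i] /=.
  by rewrite /as_poly_in_Y mmapC /of_poly_in_Y /= mmapC /= amapC.
rewrite /as_poly_in_Y mmapX mmap1U /of_poly_in_Y; case: (split_ordP i) => j ->.
  by rewrite fsumE mmapC /= amapX.
by rewrite fsumE mmapX mmap1U.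
Qed.

Lemma mpoly_ext_coefwise I p : is_ideal I ->
  mpoly_ext k I p <-> coefwise I (as_poly_in_Y p).
Proof.
move=> hI; have hcI := coefwise_is_ideal k hI; rewrite mpoly_extE; split.
  apply: (@extend_ideal_min _ _ incl I (fun p => coefwise I (as_poly_in_Y p))).
    split=> [|a x y Ix Iy]; first by rewrite rmorph0; apply: mem_ideal0.
    rewrite rmorphD rmorphM; exact: (mem_idealD hcI (mem_idealMl _ hcI Ix) Iy).
  move=> x Ix w; rewrite as_poly_in_Y_incl mcoeffC.
  exact: mem_idealMr.
move=> Ip; rewrite -(as_poly_in_YK p) /of_poly_in_Y /mmap.
have hE := extend_ideal_is_ideal incl I.
apply: (mem_ideal_sum _ hE) => w _; apply: (mem_idealMr _ hE).
exact: mem_extend_ideal.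
Qed.

Lemma mpoly_ext_incl I (x : R) : is_ideal I -> mpoly_ext k I (incl x) <-> I x.
Proof.
move=> hI; split=> [|Ix]; last by rewrite mpoly_extE; apply: mem_extend_ideal.
move/(mpoly_ext_coefwise _ hI) => /(_ 0%MM).
by rewrite as_poly_in_Y_incl mcoeffC eqxx mulr1.
Qed.

Lemma mcoeff_as_poly_in_YM p y w :
  (as_poly_in_Y (p * incl y))@_w = (as_poly_in_Y p)@_w * y.
Proof.
have -> : as_poly_in_Y (p * incl y) = as_poly_in_Y p * y%:MP.
  by rewrite rmorphM /= as_poly_in_Y_incl.
by rewrite mulrC mul_mpolyC mcoeffZ mulrC.
Qed.

(** An instance of flat base change, checked on coefficients: multiplication by an element of [R]
    acts on each coefficient in [Y] separately. *)
Lemma colon_mpoly_ext I J : is_ideal I ->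
  colon (mpoly_ext k I) (mpoly_ext k J) = mpoly_ext k (colon I J).
Proof.
move=> hI; have hC := colon_is_ideal J hI.
apply: same_idealE => p; split=> [Jp|].
  apply/(mpoly_ext_coefwise _ hC) => w y Jy.
  have : mpoly_ext k I (p * incl y).
    by apply: Jp; rewrite mpoly_extE; apply: mem_extend_ideal.
  move/(mpoly_ext_coefwise _ hI) => H.
  have E := mcoeff_as_poly_in_YM p y w.
  have {}H := H w.
  rewrite -E.
  exact: H.
move=> Cp; rewrite [mpoly_ext k J]mpoly_extE => y.
have hIx : is_ideal (mpoly_ext k I) by rewrite mpoly_extE; apply: extend_ideal_is_ideal.
apply: (@extend_ideal_min _ _ incl J (fun y => mpoly_ext k I (p * y))).
  split=> [|a x z Ix Iz]; first by rewrite mulr0; apply: mem_ideal0.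
  rewrite mulrDr mulrCA; exact: (mem_idealD hIx (mem_idealMl _ hIx Ix) Iz).
move=> x Jx; apply/(mpoly_ext_coefwise _ hI) => w.
rewrite (mcoeff_as_poly_in_YM p x w).
have /(mpoly_ext_coefwise _ hC) Cp' := Cp; exact: (Cp' w x Jx).
Qed.

Lemma mpoly_ext_prime P : prime_ideal P -> prime_ideal (mpoly_ext k P).
Proof.
move=> pP; have -> : mpoly_ext k P = (fun p => coefwise P (as_poly_in_Y p)).
  by apply: same_idealE => p; apply: mpoly_ext_coefwise; case: pP.
exact/preimage_prime/coefwise_prime.
Qed.

Lemma mpoly_ext_sub I J : subideal I J -> subideal (mpoly_ext k I) (mpoly_ext k J).
Proof.
move=> IJ; rewrite !mpoly_extE; apply: extend_ideal_min.
  exact: extend_ideal_is_ideal.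
by move=> x /IJ; apply: mem_extend_ideal.
Qed.

Lemma prime_chain_mpoly_ext P h : prime_chain P h -> prime_chain (mpoly_ext k P) h.
Proof.
case=> C [pC sC /same_idealE <-]; exists (fun i => mpoly_ext k (C i)); split=> //.
  by move=> i /pC; apply: mpoly_ext_prime.
move=> i ih; have [s1 ns] := sC i ih; split; first exact: mpoly_ext_sub.
move=> s2; apply: ns => x Cx.
have [hCi _ _] := pC i (ltnW ih); have [hCi1 _ _] := pC i.+1 ih.
by apply/(mpoly_ext_incl _ hCi)/s2/(mpoly_ext_incl _ hCi1).
Qed.

Lemma mcoeff_as_poly_in_Y p w : (as_poly_in_Y p)@_w =
  \sum_(m <- msupp p) (p@_m *: 'X_[[multinom m (lshift k i) | i < n]]) *
     ([multinom m (rshift n i) | i < k] == w)%:R.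
Proof.
rewrite /as_poly_in_Y /mmap raddf_sum /=; apply: eq_bigr => m _.
have -> : mmap1 (fsum (fun i => ('X_i)%:MP) (fun j => 'X_j)) m =
   ('X_[K, [multinom m (lshift k i) | i < n]])%:MP *
   'X_[R, [multinom m (rshift n i) | i < k]].
  rewrite /mmap1 big_split_ord /= !mpolyXE_id rmorph_prod; congr (_ * _).
    by apply: eq_bigr => i _; rewrite rmorphXn /= fsumE mnmE.
  by apply: eq_bigr => i _; rewrite fsumE mnmE.
by rewrite mulrA -mpolyCM !mul_mpolyC mcoeffZ mcoeffX.
Qed.

End ExtensionByVariables.

Section HeightOfExtension.
Variables (n k : nat) (K : fieldType).
Notation R := {mpoly K[n]}.
Implicit Types (I J P : R -> Prop).

Definition ext_vars (T : {set 'I_n}) : {set 'I_(n + k)} :=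
  [set i | fsum (fun j => j \in T) xpredT i].

Lemma card_ext_vars T : #|ext_vars T| = (#|T| + k)%N.
Proof.
rewrite -!sum1_card big_split_ord /=; congr (_ + _)%N.
  by apply: eq_bigl => i; rewrite inE fsumE.
by rewrite -[RHS](card_ord k) -sum1_card; apply: eq_bigl => i; rewrite inE fsumE.
Qed.

Lemma as_poly_in_Y_supported T (p : {mpoly K[n + k]}) w :
  supported (ext_vars T) p -> supported T (as_poly_in_Y p)@_w.
Proof.
move=> Tp m; rewrite mcoeff_as_poly_in_Y => /msupp_sum_le.
case/flattenP => _ /mapP[m' m'p ->].
rewrite mulr_natr; have [_|_] := eqVneq _ w; last by rewrite mulr0n msupp0.
rewrite mulr1n => /msuppZ_le; rewrite msuppX inE => /eqP -> i iT.
rewrite mnmE; rewrite filter_predT in m'p; apply: (Tp m' m'p).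
by rewrite inE fsumE.
Qed.

Lemma independent_mod_mpoly_ext P T : is_ideal P ->
  independent_mod P T -> independent_mod (mpoly_ext k P) (ext_vars T).
Proof.
move=> hP PT q Tq Pq; rewrite -(as_poly_in_YK q).
suff -> : as_poly_in_Y q = 0 by rewrite rmorph0.
apply/mpolyP => w; rewrite mcoeff0; apply: PT.
  exact: as_poly_in_Y_supported.
have H := proj1 (mpoly_ext_coefwise q hP) Pq; exact: H.
Qed.

(** Chains extend, so the height does not drop. It does not grow, because the [k] new variables join
    the independent set [T] and absorb the increase of [n]. *)
Lemma prime_height_mpoly_ext P h : prime_height P h -> prime_height (mpoly_ext k P) h.
Proof.
move=> hP; have [pP cP _] := hP; have [idP _ _] := pP.
have [h' [T [hP' PT e]]] := prime_height_ex pP.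
split; [exact: mpoly_ext_prime|exact: prime_chain_mpoly_ext|].
move=> l /(prime_chain_bound (independent_mod_mpoly_ext idP PT)).
by rewrite card_ext_vars (prime_heightP hP hP'); lia.
Qed.

(** A prime [Q] over the extension contracts to a prime over [I], whose extension has the same
    height and is contained in [Q]. *)
Lemma ideal_height_mpoly_ext I g : is_ideal I ->
  ideal_height I g -> ideal_height (mpoly_ext k I) g.
Proof.
move=> hI [[P [IP hP]] mI]; split.
  exists (mpoly_ext k P).
  by split; [apply: mpoly_ext_sub|apply: prime_height_mpoly_ext].
move=> Q l IQ hQ; have [pQ _ mQ] := hQ; have [idQ _ _] := pQ.
pose P' x := Q (amap (@inclX K n k) x).
have pP' : prime_ideal P' by apply: preimage_prime.
have [h [T [hP' _ _]]] := prime_height_ex pP'.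
have IP' : subideal I P'.
  by move=> x Ix; apply: IQ; rewrite mpoly_extE; apply: mem_extend_ideal.
apply: leq_trans (mI _ _ IP' hP') _.
apply: prime_height_le (prime_height_mpoly_ext hP') hQ _.
by rewrite mpoly_extE; apply: extend_ideal_min.
Qed.

End HeightOfExtension.

(** * Equivalence of ideals up to adjoining variables *)

Section StableEquivalence.
Variable K : fieldType.

(* a extends to polynomial coordinates: K[N] is a polynomial ring over the image
   of amap a. *)
Definition coordinates n N (a : 'I_n -> {mpoly K[N]}) :=
  exists k (t : 'I_(n + k) -> {mpoly K[N]}) (u : 'I_N -> {mpoly K[n + k]}),
  [/\ forall i, amap t (u i) = 'X_i, forall i, amap u (t i) = 'X_i
    & forall i, t (lshift k i) = a i].

Lemma amap_cancel n m (t : 'I_n -> {mpoly K[m]}) (u : 'I_m -> {mpoly K[n]}) :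
  (forall i, amap u (t i) = 'X_i) -> cancel (amap t) (amap u).
Proof. by move=> ut p; rewrite amap_comp (amap_eq ut) amap_id. Qed.

Lemma amap_inclX n k N (t : 'I_(n + k) -> {mpoly K[N]}) a p :
  (forall i, t (lshift k i) = a i) -> amap t (amap (@inclX K n k) p) = amap a p.
Proof.
by move=> ta; rewrite amap_comp; apply: amap_eq => i; rewrite amapX ta.
Qed.

Lemma extend_ideal_inclX n k N (t : 'I_(n + k) -> {mpoly K[N]}) a I :
  (forall i, t (lshift k i) = a i) ->
  extend_ideal (amap t) (mpoly_ext k I) = extend_ideal (amap a) I.
Proof.
move=> ta; rewrite mpoly_extE; apply: extend_ideal_comp => x; exact: amap_inclX.
Qed.

Lemma coordinates_ideal_height n N (a : 'I_n -> {mpoly K[N]}) I g :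
  coordinates a -> is_ideal I ->
  ideal_height I g -> ideal_height (extend_ideal (amap a) I) g.
Proof.
move=> [k [t [u [tu ut ta]]]] hI hg; rewrite -(extend_ideal_inclX _ ta).
have hE : is_ideal (mpoly_ext k I) by rewrite mpoly_extE; apply: extend_ideal_is_ideal.
apply: (ideal_height_iso (amap_cancel ut) (amap_cancel tu)) hE _.
exact: ideal_height_mpoly_ext.
Qed.

Lemma coordinates_colon n N (a : 'I_n -> {mpoly K[N]}) I J :
  coordinates a -> is_ideal I ->
  colon (extend_ideal (amap a) I) (extend_ideal (amap a) J) =
  extend_ideal (amap a) (colon I J).
Proof.
move=> [k [t [u [tu ut ta]]]] hI; rewrite -!(extend_ideal_inclX _ ta).
have hE L : is_ideal (mpoly_ext k L).
  by rewrite mpoly_extE; apply: extend_ideal_is_ideal.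
by rewrite (colon_iso (amap_cancel ut) (amap_cancel tu)) // colon_mpoly_ext.
Qed.

Lemma coordinates_iso n N (t : 'I_n -> {mpoly K[N]}) u :
  (forall i, amap t (u i) = 'X_i) -> (forall i, amap u (t i) = 'X_i) -> coordinates t.
Proof.
move=> tu ut; pose t' : 'I_(n + 0) -> {mpoly K[N]} := fsum t (fun _ => 0).
have t'E i : t' (lshift 0 i) = t i by rewrite /t' fsumE.
exists 0%N, t', (fun i => amap (@inclX K n 0) (u i)); split=> // i.
  by rewrite (amap_inclX _ t'E).
case: (split_ordP i) => [j ->|[]//].
by rewrite t'E -amap_comp ut amapX.
Qed.

(** The complement of the composite consists of the complement of [a] carried along by [b], followed
    by the complement of [b]. *)
Lemma coordinates_comp n N M (a : 'I_n -> {mpoly K[N]}) (b : 'I_N -> {mpoly K[M]}) :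
  coordinates a -> coordinates b -> coordinates (fun i => amap b (a i)).
Proof.
move=> [k [t [u [tu ut ta]]]] [k' [t' [u' [tu' ut' tb]]]].
pose i0 : 'I_(n + k) -> {mpoly K[n + (k + k')]} :=
  fsum (fun i => 'X_(lshift _ i)) (fun j => 'X_(rshift _ (lshift _ j))).
pose w : 'I_(N + k') -> {mpoly K[n + (k + k')]} :=
  fsum (fun i => amap i0 (u i)) (fun j => 'X_(rshift _ (rshift _ j))).
pose T : 'I_(n + (k + k')) -> {mpoly K[M]} :=
  fsum (fun i => amap b (a i))
       (fsum (fun j => amap b (t (rshift n j))) (fun j => t' (rshift N j))).
have TiE i : amap T (i0 i) = amap b (t i).
  case: (split_ordP i) => j ->; rewrite /i0 fsumE amapX /T ?fsumE //.
  by rewrite ta.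
have TwE i : amap T (w i) = t' i.
  case: (split_ordP i) => j ->; rewrite /w fsumE; last by rewrite amapX /T !fsumE.
  by rewrite amap_comp (amap_eq TiE) -amap_comp tu amapX tb.
have u'bE q : amap w (amap u' (amap b q)) = amap i0 (amap u q).
  rewrite amap_comp (amap_comp b) (amap_comp u); apply: amap_eq => i.
  by rewrite -amap_comp -tb ut' amapX /w fsumE.
exists (k + k')%N, T, (fun i => amap w (u' i)); split=> i.
- by rewrite amap_comp (amap_eq TwE) tu'.
- rewrite -amap_comp; case: (split_ordP i) => j ->; rewrite /T fsumE.
    by rewrite u'bE -ta ut amapX /i0 fsumE.
  case: (split_ordP j) => l ->; rewrite fsumE.
    by rewrite u'bE ut amapX /i0 fsumE.
  by rewrite ut' amapX /w fsumE.
- by rewrite /T fsumE.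
Qed.

(** The ring [K[m + (k + k')]] is the pushout of [K[N]] and [K[N']] over [K[m]]; [i0] and [i1] each
    insert one of the two complements. *)
Lemma coordinates_amalgam m N N' (b : 'I_m -> {mpoly K[N]})
    (b' : 'I_m -> {mpoly K[N']}) :
  coordinates b -> coordinates b' ->
  exists M (c : 'I_N -> {mpoly K[M]}) (c' : 'I_N' -> {mpoly K[M]}),
  [/\ coordinates c, coordinates c' & forall i, amap c (b i) = amap c' (b' i)].
Proof.
move=> [k [t [u [tu ut tb]]]] [k' [t' [u' [tu' ut' tb']]]].
pose i0 : 'I_(m + k) -> {mpoly K[m + (k + k')]} :=
  fsum (fun i => 'X_(lshift _ i)) (fun j => 'X_(rshift _ (lshift _ j))).
pose i1 : 'I_(m + k') -> {mpoly K[m + (k + k')]} :=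
  fsum (fun i => 'X_(lshift _ i)) (fun j => 'X_(rshift _ (rshift _ j))).
have ci0 : coordinates i0.
  exists k', (fsum i0 (fun j => 'X_(rshift _ (rshift _ j)))),
    (fsum (fun i => 'X_(lshift _ (lshift _ i)))
       (fsum (fun j => 'X_(lshift _ (rshift _ j))) (fun j => 'X_(rshift _ j)))).
  split=> i.
  - case: (split_ordP i) => j ->; last case: (split_ordP j) => l ->;
    by rewrite /i0 !fsumE amapX !fsumE.
  - case: (split_ordP i) => j ->; first case: (split_ordP j) => l ->;
    by rewrite /i0 !fsumE amapX !fsumE.
  - by rewrite fsumE.
have ci1 : coordinates i1.
  exists k, (fsum i1 (fun j => 'X_(rshift _ (lshift _ j)))),
    (fsum (fun i => 'X_(lshift _ (lshift _ i)))
       (fsum (fun j => 'X_(rshift _ j)) (fun j => 'X_(lshift _ (rshift _ j))))).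
  split=> i.
  - case: (split_ordP i) => j ->; last case: (split_ordP j) => l ->;
    by rewrite /i1 !fsumE amapX !fsumE.
  - case: (split_ordP i) => j ->; first case: (split_ordP j) => l ->;
    by rewrite /i1 !fsumE amapX !fsumE.
  - by rewrite fsumE.
exists (m + (k + k'))%N, (fun i => amap i0 (u i)), (fun i => amap i1 (u' i)); split.
- by apply: coordinates_comp ci0; apply: coordinates_iso ut tu.
- by apply: coordinates_comp ci1; apply: coordinates_iso ut' tu'.
- move=> i; rewrite -!amap_comp -tb -tb' ut ut' !amapX.
  by rewrite /i0 /i1 !fsumE.
Qed.

(** Both ideals become equal inside one common ring, which makes symmetry immediate and transitivity
    an amalgamation. The isomorphism of [equivalent_ideals] is obtained by passing through that
    ring. *)
Definition stably_equivalent n m (I : {mpoly K[n]} -> Prop)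
    (J : {mpoly K[m]} -> Prop) :=
  exists N (a : 'I_n -> {mpoly K[N]}) (b : 'I_m -> {mpoly K[N]}),
  [/\ coordinates a, coordinates b
    & extend_ideal (amap a) I = extend_ideal (amap b) J].

Lemma stably_equivalent_extend n N (a : 'I_n -> {mpoly K[N]}) I :
  coordinates a -> stably_equivalent I (extend_ideal (amap a) I).
Proof.
move=> ca; exists N, a, (fun i => 'X_i); split=> //.
  by apply: (@coordinates_iso _ _ _ (fun i => 'X_i)) => i; rewrite amapX.
by apply/esym/extend_ideal_comp => x /=; rewrite amap_id.
Qed.

Lemma stably_equivalent_sym n m (I : {mpoly K[n]} -> Prop) (J : {mpoly K[m]} -> Prop) :
  stably_equivalent I J -> stably_equivalent J I.
Proof. by move=> [N [a [b [ca cb e]]]]; exists N, b, a. Qed.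

Lemma stably_equivalent_trans n m l (I : {mpoly K[n]} -> Prop)
    (J : {mpoly K[m]} -> Prop) (L : {mpoly K[l]} -> Prop) :
  stably_equivalent I J -> stably_equivalent J L -> stably_equivalent I L.
Proof.
move=> [N [a [b [ca cb e]]]] [N' [b' [c [cb' cc e']]]].
have [M [d [d' [cd cd' de]]]] := coordinates_amalgam cb cb'.
exists M, (fun i => amap d (a i)), (fun i => amap d' (c i)); split.
- exact: coordinates_comp.
- exact: coordinates_comp.
have E p q (x : 'I_p -> {mpoly K[q]}) (y : 'I_q -> {mpoly K[M]}) (L' : _ -> Prop) :
    extend_ideal (amap (fun i => amap y (x i))) L' =
    extend_ideal (amap y) (extend_ideal (amap x) L').
  by apply/esym/extend_ideal_comp => z /=; rewrite amap_comp.
rewrite (E _ _ a d) (E _ _ c d') e -e' -(E _ _ b d) -(E _ _ b' d').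
by congr (extend_ideal (amap _) _); apply: functional_extensionality.
Qed.

(** The height is the number of rows of [Y] in the next generic link, so equivalent ideals must
    agree on it before their links can be compared. *)
Lemma stably_equivalent_ideal_height n m (I : {mpoly K[n]} -> Prop)
    (J : {mpoly K[m]} -> Prop) g h :
  is_ideal I -> is_ideal J -> stably_equivalent I J ->
  ideal_height I g -> ideal_height J h -> g = h.
Proof.
move=> hI hJ [N [a [b [ca cb e]]]] hg hh.
apply: (@ideal_heightP _ (extend_ideal (amap a) I)).
  exact: coordinates_ideal_height.
by rewrite e; apply: coordinates_ideal_height.
Qed.

Lemma stably_equivalentW n m (I : {mpoly K[n]} -> Prop) (J : {mpoly K[m]} -> Prop) :
  stably_equivalent I J -> equivalent_ideals I J.
Proof.
move=> [N [a [b [[k [t [u [tu ut ta]]]] [l [t' [u' [tu' ut' tb]]]] e]]]].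
exists k, l, (amap (fun i => amap u' (t i))); split.
  exists (amap (fun i => amap u (t' i))) => p /=.
    rewrite -(amap_comp t u') -(amap_comp t' u).
    by rewrite (amap_cancel tu') (amap_cancel ut).
  rewrite -(amap_comp t u') -(amap_comp t' u).
  by rewrite (amap_cancel tu) (amap_cancel ut').
move=> p /=; rewrite -(amap_comp t u').
have hE q r (L : {mpoly K[q]} -> Prop) : is_ideal (mpoly_ext r L).
  by rewrite mpoly_extE; apply: extend_ideal_is_ideal.
have E1 := extend_ideal_iso (amap_cancel ut) (amap_cancel tu) (hE _ k I).
have E2 := extend_ideal_iso (amap_cancel ut') (amap_cancel tu') (hE _ l J).
rewrite -[X in mpoly_ext k I X](amap_cancel ut).
rewrite -[mpoly_ext k I _]/((fun y => mpoly_ext k I (amap u y)) (amap t p)) -E1.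
rewrite -[mpoly_ext l J _]/((fun y => mpoly_ext l J (amap u' y)) (amap t p)) -E2.
by rewrite (extend_ideal_inclX _ ta) (extend_ideal_inclX _ tb) e.
Qed.

End StableEquivalence.

(** * Uniqueness of generic links *)

Section GenericLinks.
Variable K : fieldType.

Definition on_entries g r (X : Type) (h : 'I_g -> 'I_r -> X) (z : 'I_(g * r)) : X :=
  mxvec (\matrix_(i, j) h i j) 0 z.

Lemma on_entriesE g r X (h : 'I_g -> 'I_r -> X) i j :
  on_entries h (mxvec_index i j) = h i j.
Proof. by rewrite /on_entries mxvecE mxE. Qed.

Lemma generic_linkE n g r (f : r.-tuple {mpoly K[n]}) I :
  @generic_link K n g r f I =
  colon (ideal_gen (generic_combinations g f)) (mpoly_ext (g * r) I).
Proof. by []. Qed.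

(** Colons commute with coordinate maps, so a generic link may be computed after substituting for
    its variables; every comparison of links below goes through this form. *)
Lemma extend_generic_link n N g r (f : r.-tuple {mpoly K[n]}) I
    (a : 'I_(n + g * r) -> {mpoly K[N]}) (c : 'I_n -> {mpoly K[N]}) :
  coordinates a -> (forall i, a (lshift (g * r) i) = c i) ->
  extend_ideal (amap a) (generic_link g f I) =
  colon (ideal_gen [seq \sum_(j < r) a (rshift n (mxvec_index i j)) * amap c (tnth f j)
                   | i <- enum 'I_g])
        (extend_ideal (amap c) I).
Proof.
move=> ca ac; rewrite generic_linkE -coordinates_colon //.
rewrite (extend_ideal_inclX _ ac) extend_ideal_gen; congr (colon (ideal_gen _) _).
rewrite /generic_combinations /= -map_comp; apply: eq_map => i /=.
rewrite rmorph_sum; apply: eq_bigr => j _; rewrite rmorphM /= amapX.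
by rewrite mpoly_inclE (amap_inclX _ ac).
Qed.

Lemma coordinates_widen n N l (a : 'I_n -> {mpoly K[N]}) : coordinates a ->
  coordinates (fsum (fun i => amap (@inclX K N l) (a i)) (fun j => 'X_(rshift N j))).
Proof.
move=> [k [t [u [tu ut ta]]]]; set a' := fsum _ _.
pose T := fsum a' (fun j : 'I_k => amap (@inclX K N l) (t (rshift n j))).
pose w : 'I_(n + k) -> {mpoly K[(n + l) + k]} :=
  fsum (fun i => 'X_(lshift _ (lshift _ i))) (fun j => 'X_(rshift _ j)).
pose U : 'I_(N + l) -> {mpoly K[(n + l) + k]} :=
  fsum (fun i => amap w (u i)) (fun j => 'X_(lshift _ (rshift _ j))).
have Tw i : amap T (w i) = amap (@inclX K N l) (t i).
  case: (split_ordP i) => j ->; rewrite /w fsumE amapX /T fsumE // /a' fsumE.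
  by rewrite ta.
have Uincl q : amap U (amap (@inclX K N l) q) = amap w (amap u q).
  rewrite [LHS](@amap_inclX _ _ _ _ _ (fun i => amap w (u i))); last first.
    by move=> i; rewrite /U fsumE.
  by rewrite amap_comp.
exists k, T, U; split=> i; last by rewrite /T fsumE.
- case: (split_ordP i) => j ->; rewrite /U fsumE; last first.
    by rewrite amapX /T fsumE /a' fsumE.
  by rewrite amap_comp (amap_eq Tw) -(amap_comp t) tu amapX.
- case: (split_ordP i) => j ->; last by rewrite /T fsumE Uincl ut amapX /w fsumE.
  rewrite /T fsumE /a'; case: (split_ordP j) => l' ->; rewrite fsumE.
    by rewrite Uincl -ta ut amapX /w fsumE.
  by rewrite amapX /U fsumE.
Qed.

(** Forming [Y f] commutes with enlarging the base ring, the matrix [Y] being the same on both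
    sides. *)
Lemma generic_link_extend n N (a : 'I_n -> {mpoly K[N]}) g r
    (f : r.-tuple {mpoly K[n]}) I :
  coordinates a ->
  stably_equivalent (generic_link g f I)
    (generic_link g (map_tuple (amap a) f) (extend_ideal (amap a) I)).
Proof.
move=> ca; set J := generic_link g (map_tuple _ _) _.
have ca' := coordinates_widen (g * r) ca; set a' := fsum _ _ in ca'.
have a'l i : a' (lshift (g * r) i) = amap (@inclX K N (g * r)) (a i).
  by rewrite /a' fsumE.
suff -> : J = extend_ideal (amap a') (generic_link g f I).
  exact: stably_equivalent_extend.
have id_c : coordinates (fun i : 'I_(N + g * r) => 'X_i : {mpoly K[N + g * r]}).
  by apply: (@coordinates_iso _ _ _ _ (fun i => 'X_i)) => i; rewrite amapX.
rewrite (extend_generic_link _ _ ca' a'l).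
(* [J] is written as an extension along the identity, so that both sides take the form computed by
   [extend_generic_link]. *)
have -> : J = extend_ideal (amap (fun i => 'X_i)) J.
  apply: same_idealE => x; rewrite (extend_ideal_iso (psi := amap (fun i => 'X_i))).
  - by rewrite /= amap_id.
  - by move=> y /=; rewrite !amap_id.
  - by move=> y /=; rewrite !amap_id.
  - exact/colon_is_ideal.
rewrite (@extend_generic_link _ _ _ _ _ _ _ (@inclX K N (g * r)) id_c) //.
have E : extend_ideal (amap (fun i => amap (@inclX K N (g * r)) (a i))) I =
    extend_ideal (amap (@inclX K N (g * r))) (extend_ideal (amap a) I).
  by apply/esym/extend_ideal_comp => x /=; rewrite amap_comp.
rewrite E; congr (colon (ideal_gen _) _); apply: eq_map => i.
apply: eq_bigr => j _; rewrite /a' fsumE tnth_map.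
by rewrite -(amap_comp a (@inclX K N (g * r))).
Qed.

Section Shear.
Variables (n g r r' : nat) (A : 'I_r' -> 'I_r -> {mpoly K[n]}).
Notation M := ((n + g * r) + g * r')%N.

Definition inclX2 (i : 'I_n) : {mpoly K[M]} := 'X_(lshift _ (lshift _ i)).
Definition varY i j : {mpoly K[M]} := 'X_(lshift _ (rshift _ (mxvec_index i j))).
Definition varZ i j : {mpoly K[M]} := 'X_(rshift _ (mxvec_index i j)).

(* The substitution Y := Y + c Z A. *)
Definition shear (c : K) : 'I_M -> {mpoly K[M]} :=
  fsum (fsum inclX2 (on_entries (fun i j =>
          varY i j + c%:MP * \sum_(l < r') varZ i l * amap inclX2 (A l j))))
       (fun z => 'X_(rshift _ z)).

Lemma shear_inclX2 c q : amap (shear c) (amap inclX2 q) = amap inclX2 q.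
Proof.
by rewrite amap_comp; apply: amap_eq => i; rewrite amapX /shear !fsumE.
Qed.

Lemma shear_varZ c i j : amap (shear c) (varZ i j) = varZ i j.
Proof. by rewrite amapX /shear fsumE. Qed.

Lemma shear_varY c i j : amap (shear c) (varY i j) =
  varY i j + c%:MP * \sum_(l < r') varZ i l * amap inclX2 (A l j).
Proof. by rewrite amapX /shear !fsumE on_entriesE. Qed.

(** The increment [Z A] involves only [Z] and the old variables, which the opposite shear fixes;
    hence it cancels. *)
Lemma shearK c i : amap (shear (- c)) (shear c i) = 'X_i.
Proof.
case: (split_ordP i) => z ->; last by rewrite /shear fsumE amapX fsumE.
case: (split_ordP z) => {z} [z|z] ->.
  by rewrite {2}/shear !fsumE amapX /shear !fsumE.
case: (mxvec_indexP z) => {z} a b.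
rewrite {2}/shear !fsumE on_entriesE rmorphD rmorphM rmorph_sum /= amapC shear_varY.
under eq_bigr => l _ do rewrite rmorphM /= shear_varZ shear_inclX2.
by rewrite mpolyCN mulNr subrK.
Qed.

Lemma coordinates_shear : coordinates (fun z => shear 1 (lshift (g * r') z)).
Proof.
exists (g * r')%N, (shear 1), (shear (- 1)); split=> // i; last exact: shearK.
by rewrite -[X in shear X]opprK shearK.
Qed.

Lemma extend_generic_link_shear (f : r.-tuple {mpoly K[n]})
    (f' : r'.-tuple {mpoly K[n]}) I :
  (forall l, tnth f' l = \sum_(j < r) A l j * tnth f j) ->
  extend_ideal (amap (fun z => shear 1 (lshift (g * r') z))) (generic_link g f I) =
  colon (ideal_gen [seq \sum_(j < r) varY i j * amap inclX2 (tnth f j) +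
                        \sum_(l < r') varZ i l * amap inclX2 (tnth f' l)
                   | i <- enum 'I_g])
        (extend_ideal (amap inclX2) I).
Proof.
move=> f'E;
  rewrite (extend_generic_link _ _ coordinates_shear (c := inclX2)); last first.
  by move=> i; rewrite /shear !fsumE.
congr (colon (ideal_gen _) _); apply: eq_map => i.
under eq_bigr => j _ do rewrite /shear !fsumE on_entriesE mul1r mulrDl mulr_suml.
rewrite big_split; congr (_ + _); rewrite exchange_big; apply: eq_bigr => l _ /=.
rewrite f'E rmorph_sum mulr_sumr; apply: eq_bigr => j _ /=.
by rewrite rmorphM mulrA.
Qed.

End Shear.

Lemma ideal_gen_coefficients n r r' (f : r.-tuple {mpoly K[n]})
    (f' : r'.-tuple {mpoly K[n]}) : subideal (ideal_gen f') (ideal_gen f) ->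
  exists A : 'I_r' -> 'I_r -> {mpoly K[n]},
    forall l, tnth f' l = \sum_(j < r) A l j * tnth f j.
Proof.
move=> sf; have H l : exists A : nat -> {mpoly K[n]},
    tnth f' l = \sum_(j < r) A j * tnth f j.
  have [c ->] : ideal_gen f (tnth f' l) by apply/sf/mem_ideal_gen/mem_tnth.
  exists c; rewrite size_tuple; apply: eq_bigr => j _.
  by rewrite (tnth_nth 0).
pose A l := proj1_sig (constructive_indefinite_description _ (H l)).
exists (fun l j => A l j) => l.
by rewrite /A; case: constructive_indefinite_description.
Qed.

(* Adjoining both Y and Z, the shears Y := Y + Z A and Z := Z + Y B send Y f and
   Z f' to the common value Y f + Z f', when f' = A f and f = B f'. *)
Lemma generic_link_generators n g r r' (f : r.-tuple {mpoly K[n]})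
    (f' : r'.-tuple {mpoly K[n]}) I :
  ideal_gen f = ideal_gen f' ->
  stably_equivalent (generic_link g f I) (generic_link g f' I).
Proof.
move=> ff'; have [|A AE] := @ideal_gen_coefficients _ _ _ f f'; first by rewrite ff'.
have [|B BE] := @ideal_gen_coefficients _ _ _ f' f; first by rewrite ff'.
(* The second link lives in the ring where [Z] is adjoined before [Y]; [swap] exchanges the two
   blocks of variables. *)
pose swap r r' : 'I_((n + g * r') + g * r) -> {mpoly K[(n + g * r) + g * r']} :=
  fsum (fsum (@inclX2 n g r r') (fun z => 'X_(rshift _ z)))
       (fun z => 'X_(lshift _ (rshift _ z))).
have swapK r1 r2 i : amap (swap r1 r2) (swap r2 r1 i) = 'X_i.
  case: (split_ordP i) => z ->; last by rewrite /swap !fsumE amapX !fsumE.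
  by case: (split_ordP z) => {z} z ->; rewrite /swap !fsumE amapX !fsumE.
have c_swap : coordinates (swap r r').
  by apply: (coordinates_iso (u := swap r' r)) => i; apply: swapK.
have c_b := coordinates_comp (coordinates_shear g B) c_swap.
exists ((n + g * r) + g * r')%N, (fun z => shear A 1 (lshift (g * r') z)),
  (fun z => amap (swap r r') (shear B 1 (lshift (g * r) z))).
split; [exact: coordinates_shear|exact: c_b|].
rewrite (extend_generic_link_shear _ _ AE).
rewrite -(@extend_ideal_comp _ _ _ (amap (fun z => shear B 1 (lshift (g * r) z)))
   (amap (swap r r'))); last by move=> x /=; rewrite amap_comp.
rewrite (extend_generic_link_shear _ _ BE) -coordinates_colon // extend_ideal_gen.
have swap2 q : amap (swap r r') (amap (@inclX2 n g r' r) q) = amap (@inclX2 n g r r') q.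
  by rewrite amap_comp; apply: amap_eq => i; rewrite amapX /swap !fsumE.
congr (colon (ideal_gen _) _); last first.
  by apply/esym/extend_ideal_comp => x; apply: swap2.
rewrite -[RHS]map_comp; apply: eq_map => i /=; rewrite rmorphD !rmorph_sum /= addrC.
congr (_ + _); apply: eq_bigr => j _; rewrite rmorphM /= swap2 amapX.
  by rewrite /swap !fsumE.
by rewrite /swap !fsumE.
Qed.

(** In the common extension the two ideals coincide, and only their generating sets differ. *)
Lemma generic_link_stably_equivalent n m g (I : {mpoly K[n]} -> Prop)
    (J : {mpoly K[m]} -> Prop) r r' (f : r.-tuple {mpoly K[n]})
    (f' : r'.-tuple {mpoly K[m]}) :
  I = ideal_gen f -> J = ideal_gen f' -> stably_equivalent I J ->
  stably_equivalent (generic_link g f I) (generic_link g f' J).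
Proof.
move=> If Jf' [N [a [b [ca cb e]]]].
apply: stably_equivalent_trans (generic_link_extend g f I ca) _.
apply/stably_equivalent_sym.
apply: stably_equivalent_trans (generic_link_extend g f' J cb) _.
rewrite -e; apply: generic_link_generators => /=.
by rewrite -(extend_ideal_gen (amap a) f) -(extend_ideal_gen (amap b) f') -If -Jf'.
Qed.

(** The number of variables varies together with the ideal, so [J] is identified with a link through
    all predicates [Q] on such pairs instead of an equality across different rings. *)
Lemma nth_generic_link_inv n (I : {mpoly K[n]} -> Prop) k m (J : {mpoly K[m]} -> Prop) :
  nth_generic_link I k J ->
  if k is k'.+1 then
    exists m0 (J0 : {mpoly K[m0]} -> Prop) g r (f : r.-tuple {mpoly K[m0]}),
    [/\ nth_generic_link I k' J0, is_ideal J0, ideal_height J0 g, J0 = ideal_gen f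
      & forall Q : forall m, ({mpoly K[m]} -> Prop) -> Prop,
          Q _ (generic_link g f J0) -> Q _ J]
  else forall Q : forall m, ({mpoly K[m]} -> Prop) -> Prop, Q n I -> Q m J.
Proof.
case=> {k m J} [//|k m J g r f IkJ [idJ _ _] hJ _ /same_idealE Jf].
by exists m, J, g, r, f; split.
Qed.

Lemma nth_generic_link_unique n (I : {mpoly K[n]} -> Prop) k m m'
    (J : {mpoly K[m]} -> Prop) (J' : {mpoly K[m']} -> Prop) :
  nth_generic_link I k J -> nth_generic_link I k J' -> stably_equivalent J J'.
Proof.
elim: k m J m' J' => [|k IHk] m J m' J'.
  move=> /nth_generic_link_inv HJ /nth_generic_link_inv HJ'.
  apply: (HJ' (fun m' J' => stably_equivalent J J')).
  apply: (HJ (fun m J => stably_equivalent J I)).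
  have c_id : coordinates (fun i : 'I_n => 'X_i : {mpoly K[n]}).
    by apply: (@coordinates_iso _ _ _ _ (fun i => 'X_i)) => i; rewrite amapX.
  by exists n, (fun i => 'X_i), (fun i => 'X_i).
move=> /nth_generic_link_inv [m0 [J0 [g [r [f [L idJ h e QJ]]]]]].
move=> /nth_generic_link_inv [m0' [J0' [g' [r' [f' [L' idJ' h' e' QJ']]]]]].
have JJ' := IHk _ _ _ _ L L'.
have gg' := stably_equivalent_ideal_height idJ idJ' JJ' h h'.
rewrite -gg' in QJ'.
apply: (QJ' (fun m' J' => stably_equivalent J J')).
apply: (QJ (fun m J => stably_equivalent J (generic_link g f' J0'))).
exact: generic_link_stably_equivalent.
Qed.

End GenericLinks.

(** * A generic link with property P *)

Section LexTermOrder.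
Variables (N n : nat) (wt : 'X_{1..N} -> nat) (lf : 'X_{1..N} -> 'X_{1..n}).
Variable ord : rel 'X_{1..n}.
Hypotheses (wt0 : wt 0%MM = 0%N) (wtD : forall a b, wt (a + b)%MM = (wt a + wt b)%N).
Hypotheses (lf0 : lf 0%MM = 0%MM) (lfD : forall a b, lf (a + b)%MM = (lf a + lf b)%MM).
Hypothesis ord_term : term_order ord.

(** The maps [wt] and [lf] are additive but need not separate monomials; the last comparison breaks
    the remaining ties and gives antisymmetry. *)
Definition lex_order : rel 'X_{1..N} := fun m1 m2 =>
  if wt m1 == wt m2 then
    if lf m1 == lf m2 then (m1 <= m2)%O else ord (lf m1) (lf m2)
  else (wt m1 < wt m2)%N.

Lemma lex_term_order : term_order lex_order.
Proof.
split; first split.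
- by move=> m; rewrite /lex_order !eqxx Order.POrderTheory.lexx.
- move=> m1 m2; rewrite /lex_order [wt m2 == _]eq_sym [lf m2 == _]eq_sym.
  case: eqP => [_|_]; last by case: ltngtP.
  case: eqP => [_|ne] H; first exact: Order.POrderTheory.le_anti.
  by case: ne; apply: (ord_anti ord_term).
- move=> m2 m1 m3; rewrite /lex_order.
  case: (ltngtP (wt m1) (wt m2)) => // [lt12|e12].
    case: (ltngtP (wt m2) (wt m3)) => // [lt23|e23] _ _.
      by rewrite ltn_eqF (ltn_trans lt12 lt23).
    by rewrite -e23 lt12 ltn_eqF.
  rewrite e12; case: (ltngtP (wt m2) (wt m3)) => // _.
  case: (eqVneq (lf m1) (lf m2)) => [->|ne12].
    case: (eqVneq (lf m2) (lf m3)) => // _.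
    exact: Order.POrderTheory.le_trans.
  case: (eqVneq (lf m2) (lf m3)) => [<-|ne23]; first by rewrite (negPf ne12).
  case: (eqVneq (lf m1) (lf m3)) => [e13|_]; last exact: (ord_trans ord_term).
  move=> h1 h2; case/eqP: ne12; apply: (ord_anti ord_term).
  by rewrite h1 e13.
- move=> m1 m2; rewrite /lex_order.
  case: (ltngtP (wt m1) (wt m2)) => // _.
  rewrite [lf m2 == _]eq_sym; case: eqP => _; last exact: (ord_total ord_term).
  exact: Order.TotalTheory.le_total.
- split=> [m|m1 m2 m].
    rewrite /lex_order wt0 lf0; case: (wt m) => //=.
    case: eqP => _; [exact: le0m|exact: (ord0m ord_term)].
  rewrite /lex_order !wtD !lfD eqn_add2r ltn_add2r.
  have -> : (lf m1 + lf m == lf m2 + lf m)%MM = (lf m1 == lf m2).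
    by rewrite eqm_add2r.
  case: eqP => // _; case: eqP => _; first by rewrite lemc_add2l.
  by rewrite (ord_add2r ord_term).
Qed.

End LexTermOrder.

Section WeightedMeasure.
Variables (n : nat) (w : 'I_n -> nat).

Definition weighted_deg (m : 'X_{1..n}) := (\sum_(i < n) m i * w i)%N.

Lemma weighted_deg0 : weighted_deg 0%MM = 0%N.
Proof. by rewrite /weighted_deg big1 // => i _; rewrite mnm0E. Qed.

Lemma weighted_degD : {morph weighted_deg : m1 m2 / (m1 + m2)%MM >-> (m1 + m2)%N}.
Proof.
move=> m1 m2; rewrite /weighted_deg -big_split; apply: eq_bigr => i _ /=.
by rewrite mnmDE mulnDl.
Qed.

HB.instance Definition _ :=
  isMeasure.Build n weighted_deg weighted_deg0 weighted_degD.

Lemma weighted_degU i : weighted_deg U_(i)%MM = w i.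
Proof.
rewrite /weighted_deg (bigD1 i) //= mnm1E eqxx mul1n big1 ?addn0 // => j.
by rewrite mnm1E eq_sym => /negPf ->.
Qed.

End WeightedMeasure.

Section Embedding.
Variables (n k : nat) (K : fieldType).

Definition emb_mnm (m : 'X_{1..n}) : 'X_{1..n + k} :=
  [multinom fsum m (fun=> 0%N) i | i < n + k].

Definition left_mnm (m : 'X_{1..n + k}) : 'X_{1..n} :=
  [multinom m (lshift k i) | i < n].

Lemma emb_mnml m i : emb_mnm m (lshift k i) = m i.
Proof. by rewrite mnmE fsumE. Qed.

Lemma emb_mnmr m i : emb_mnm m (rshift n i) = 0%N.
Proof. by rewrite mnmE fsumE. Qed.

Lemma emb_mnmK : cancel emb_mnm left_mnm.
Proof. by move=> m; apply/mnmP => i; rewrite !mnmE fsumE. Qed.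

Lemma amap_inclXE (p : {mpoly K[n]}) :
  amap (@inclX K n k) p = \sum_(m <- msupp p) p@_m *: 'X_[emb_mnm m].
Proof.
rewrite /amap /mmap; apply: eq_bigr => m _; rewrite mul_mpolyC; congr (_ *: _).
rewrite /mmap1 mpolyXE_id big_split_ord /= [X in _ * X]big1 ?mulr1 => [|i _].
  by apply: eq_bigr => i _; rewrite mnmE fsumE.
by rewrite mnmE fsumE expr0.
Qed.

Lemma msupp_amap_inclX (p : {mpoly K[n]}) m :
  m \in msupp (amap (@inclX K n k) p) -> exists2 m', m' \in msupp p & m = emb_mnm m'.
Proof.
rewrite amap_inclXE => /msupp_sum_le /flattenP [_ /mapP[m' m'p ->] /msuppZ_le].
rewrite filter_predT in m'p; rewrite msuppX inE => /eqP ->; by exists m'.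
Qed.

Lemma mcoeff_amap_inclX (p : {mpoly K[n]}) m :
  (amap (@inclX K n k) p)@_(emb_mnm m) = p@_m.
Proof.
rewrite amap_inclXE [in RHS](mpolyE p) !raddf_sum /=; apply: eq_bigr => m' _.
by rewrite !mcoeffZ !mcoeffX (can_eq emb_mnmK).
Qed.

Lemma amap_inclX_homog (mf : measure n) (mf' : measure (n + k)) e (p : {mpoly K[n]}) :
  (forall i, mf' U_(lshift k i)%MM = mf U_(i)%MM) ->
  p \is e.-homog for mf -> amap (@inclX K n k) p \is e.-homog for mf'.
Proof.
move=> mfE' /dhomogP hp; apply/dhomogP => m /msupp_amap_inclX [m' m'p ->].
rewrite -(hp _ m'p) [LHS]mfE [RHS]mfE big_split_ord /=
  [X in (_ + X)%N]big1 ?addn0 => [|i _].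
  by apply: eq_bigr => i _; rewrite mnmE fsumE mfE'.
by rewrite mnmE fsumE.
Qed.

End Embedding.

(** The homogeneous components of the members of any finite generating set stay in [I] and generate
    it. *)
Lemma homogeneous_basis n (K : fieldType) (mf : measure n) (I : {mpoly K[n]} -> Prop) :
  is_ideal I -> homogeneous_ideal mf I ->
  exists s, (forall p, p \in s -> p \is homog mf) /\ I = ideal_gen s.
Proof.
move=> hI homI; have [s0 Is0] := hilbert_basis hI.
pose s := flatten [seq [seq pihomog mf d p | d <- iota 0 (mmeasure mf p)] | p <- s0].
have sP q : q \in s -> exists p d, p \in s0 /\ q = pihomog mf d p.
  by case/flattenP => _ /mapP[p ps ->] /mapP[d _ ->]; exists p, d.
exists s; split.
  by move=> q /sP [p [d [_ ->]]]; apply/homogP; exists d; apply: pihomogP.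
apply: same_idealE => x; split; last first.
  apply: ideal_gen_min => // q /sP [p [d [ps ->]]]; apply: homI.
  by rewrite Is0; apply: mem_ideal_gen.
rewrite {1}Is0; apply: ideal_gen_min => // p ps.
rewrite (pihomog_partitionE (mf := mf) (leqnn (mmeasure mf p))).
apply: mem_ideal_sum => // d _; apply: mem_ideal_gen; apply/flattenP.
exists [seq pihomog mf d p | d <- iota 0 (mmeasure mf p)]; first exact: map_f.
by apply: map_f; rewrite mem_iota add0n ltn_ord.
Qed.

(** * One generic link, built on [alpha] and homogeneous generators *)

Section GenericLinkStep.
Variables (K : fieldType) (n : nat) (mf : measure n) (I : {mpoly K[n]} -> Prop).
Variables (ord : rel 'X_{1..n}) (g : nat) (alpha : g.-tuple {mpoly K[n]}).
Hypotheses (mf_gt0 : positive_grading mf) (idI : is_ideal I).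
Hypothesis ord_term : term_order ord.
Hypotheses (Palpha : P_sequence mf I ord alpha) (g_gt0 : (0 < g)%N).
Variable s : seq {mpoly K[n]}.
Hypotheses (s_homog : forall p, p \in s -> p \is homog mf) (Is : I = ideal_gen s).

Let r := (g + size s)%N.
(** The sequence [alpha] is repeated in front of the generators so that the diagonal variable
    [Y i i] multiplies [alpha_i]. *)
Let f : r.-tuple {mpoly K[n]} := cat_tuple alpha (in_tuple s).
Let beta := generic_combinations g f.
Notation N := (n + g * r)%N.
Notation incl := (amap (@inclX K n (g * r))).

Lemma link_generators : I = ideal_gen f.
Proof.
rewrite Is; apply: same_idealE => x; split.
  by apply: ideal_gen_sub => p ps; rewrite /= mem_cat ps orbT.
apply: ideal_gen_min => // p; rewrite /= mem_cat => /orP[|/mem_ideal_gen //].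
by rewrite -Is => pa; apply: (P_sequence_sub idI Palpha); apply: mem_ideal_gen.
Qed.

Let f_homog j : tnth f j \is homog mf.
Proof.
have : tnth f j \in (f : seq _) by apply: mem_tnth.
rewrite /= mem_cat => /orP[/tnthP[i ->]|/s_homog //].
by case: Palpha => H _ _; case: (H i).
Qed.

(** For a nonzero polynomial [mmeasure] is one more than the degree, and it is 0 for the zero
    polynomial. The sum [D] serves as a common upper bound of the degrees [e j]. *)
Let e j := (mmeasure mf (tnth f j)).-1.
Let D := (\sum_(j < r) e j)%N.

(* The weight of Y i j makes Y i j * f_j homogeneous of degree D + 1. *)
Definition link_weight : 'I_N -> nat :=
  fsum (fun i => mf U_(i)%MM) (on_entries (fun (i : 'I_g) j => (D - e j).+1)).

Definition link_measure : measure N := weighted_deg link_weight.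

Lemma link_measure_positive : positive_grading link_measure.
Proof.
move=> i; rewrite /= weighted_degU /link_weight; case: (split_ordP i) => z ->.
  by rewrite fsumE mf_gt0.
by rewrite fsumE; case: (mxvec_indexP z) => a b; rewrite on_entriesE.
Qed.

Lemma link_measure_lshift i : link_measure U_(lshift (g * r) i)%MM = mf U_(i)%MM.
Proof. by rewrite /= weighted_degU /link_weight fsumE. Qed.

Lemma link_measure_extends : extends_grading mf link_measure.
Proof.
move=> i j ij; have -> : j = lshift (g * r) i by apply: val_inj.
exact: link_measure_lshift.
Qed.

Let incl_homog j : incl (tnth f j) \is (e j).-homog for link_measure.
Proof.
apply: (amap_inclX_homog link_measure_lshift).
rewrite -homog_msize; exact: f_homog.
Qed.

Let betaE i : tnth beta i =
  \sum_(j < r) 'X_(rshift n (mxvec_index i j)) * incl (tnth f j).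
Proof. by rewrite tnth_mktuple; apply: eq_bigr => j _; rewrite mpoly_inclE. Qed.

Let beta_homog i : tnth beta i \is homog link_measure.
Proof.
apply/homogP; exists D.+1; rewrite betaE; apply: rpred_sum => j _.
have -> : D.+1 = ((D - e j).+1 + e j)%N.
  by rewrite addSn subnK // /D (bigD1 j) //= leq_addr.
apply: dhomogM => //; rewrite dhomogX; apply/eqP.
by rewrite /= weighted_degU /link_weight fsumE on_entriesE.
Qed.

Let diag (i : 'I_g) : 'I_N := rshift n (mxvec_index i (lshift (size s) i)).

Definition diag_weight (m : 'X_{1..N}) := (\sum_(i < g) m (diag i))%N.

(* Ranking first by the exponents of the diagonal entries Y i i, then by ord on
   the old variables, gives in(beta_i) = Y i i * in(alpha_i). *)
Definition link_order : rel 'X_{1..N} :=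
  lex_order diag_weight (@left_mnm n (g * r)) ord.

Lemma link_order_term : term_order link_order.
Proof.
apply: lex_term_order ord_term.
- by rewrite /diag_weight big1 // => i _; rewrite mnm0E.
- by move=> a b; rewrite /diag_weight -big_split; apply: eq_bigr => i _; rewrite mnmDE.
- by apply/mnmP => i; rewrite mnmE !mnm0E.
- by move=> a b; apply/mnmP => i; rewrite !(mnmE, mnmDE).
Qed.

Let mxvec_index_eq i j i' j' :
  (mxvec_index i j == mxvec_index i' j' :> 'I_(g * r)) = (i == i') && (j == j').
Proof.
by rewrite /mxvec_index (inj_eq (@cast_ord_inj _ _ _)) (inj_eq enum_rank_inj) xpair_eqE.
Qed.

Let diag_eq i i' j : (diag i' == rshift n (mxvec_index i j)) =
  (i' == i) && (j == lshift (size s) i).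
Proof.
rewrite /diag (inj_eq (@rshift_inj _ _)) mxvec_index_eq.
by case: eqP => //= ->; rewrite eq_sym.
Qed.

Let fl i : tnth f (lshift (size s) i) = tnth alpha i.
Proof. exact: tnth_lshift. Qed.

Let lead i := (U_(diag i) + emb_mnm (g * r) (initial_monomial ord (tnth alpha i)))%MM.

Let msupp_term i j m :
  m \in msupp ('X_(rshift n (mxvec_index i j)) * incl (tnth f j)) ->
  exists2 m', m' \in msupp (tnth f j) &
    m = (U_(rshift n (mxvec_index i j)) + emb_mnm (g * r) m')%MM.
Proof.
move/msuppM_le/allpairsP => [[a b] /= []]; rewrite msuppX inE => /eqP ->.
by case/msupp_amap_inclX => m' m'f -> ->; exists m'.
Qed.

Let lead_diag i i' : lead i (diag i') = (i == i').
Proof.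
rewrite /lead mnmDE [emb_mnm _ _ _]emb_mnmr addn0 mnm1E.
by rewrite [_ == _](diag_eq i' i (lshift (size s) i')) eqxx andbT.
Qed.

Lemma initial_link i : initial_monomial link_order (tnth beta i) = lead i.
Proof.
have [Pa _ _] := Palpha; have [_ a0 _] := Pa i.
apply: (lm_eq link_order_term).
  rewrite mcoeff_msupp betaE raddf_sum (bigD1 (lshift (size s) i)) //= big1 ?addr0.
    rewrite mulrC mcoeffMX mcoeff_amap_inclX fl; exact: lm_coeff_neq0.
  move=> j ji; apply: memN_msupp_eq0; apply/negP => /msupp_term [m' _].
  move/(congr1 (fun m : 'X_{1..N} => m (rshift n (mxvec_index i j)))).
  by rewrite /lead !mnmDE !emb_mnmr !mnm1E diag_eq eqxx (negPf ji) eqxx.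
move=> m; rewrite betaE => /msupp_sum_le /flattenP [_ /mapP[j _ ->]].
case/msupp_term => m' m'f ->.
(* A monomial of the summand [j'] has diagonal weight 1 if that summand is the diagonal one and 0
   otherwise, so only the diagonal summand competes for the initial monomial. *)
have wE i' j' m2 :
    diag_weight (U_(rshift n (mxvec_index i' j')) + emb_mnm (g * r) m2)%MM =
    (j' == lshift (size s) i').
  rewrite /diag_weight (bigD1 i') //= big1 => [|i2 ne].
    by rewrite mnmDE mnm1E emb_mnmr eq_sym diag_eq eqxx !addn0.
  by rewrite mnmDE mnm1E emb_mnmr eq_sym diag_eq (negPf ne).
have lE z m2 : left_mnm (U_(rshift n z) + emb_mnm (g * r) m2)%MM = m2.
  by apply/mnmP => c; rewrite mnmE mnmDE mnm1E emb_mnml eq_sym eq_lrshift.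
rewrite /link_order /lex_order /lead !wE !lE eqxx.
case: (eqVneq j (lshift (size s) i)) => [ej|_] //=.
rewrite ej fl in m'f *; case: eqP => [->|_].
  exact: Order.POrderTheory.lexx.
exact: lm_max.
Qed.

(** The initial monomial of zero is the default [0%MM], whereas [lead i] contains the variable
    [Y i i]. *)
Let beta_neq0 i : tnth beta i != 0.
Proof.
apply/eqP => b0; have := initial_link i; rewrite b0 => e0.
have := lead_diag i i; rewrite -e0 eqxx.
by rewrite /initial_monomial msupp0 big_nil mnm0E.
Qed.

Let beta_P : P_sequence link_measure (fun=> True) link_order beta.
Proof.
have [Pa sqa copa] := Palpha; split=> [i|i z|i i' ne].
- by split; [|apply: beta_neq0|apply: beta_homog].
- rewrite initial_link /lead mnmDE mnm1E.
  case: (split_ordP z) => c ->; last by rewrite emb_mnmr addn0 leq_b1.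
  by rewrite emb_mnml eq_sym eq_lrshift; apply: sqa.
- move=> z; rewrite !initial_link /lead !mnmDE !mnm1E.
  case: (split_ordP z) => c ->; rewrite ?emb_mnml ?emb_mnmr.
    by rewrite ![_ == lshift _ _]eq_sym !eq_lrshift; apply: copa.
  case: eqP => [ec|_]; last by left.
  right; rewrite addn0; apply/eqP; rewrite eqb0 -ec; apply: contraNneq ne => eii.
  have := diag_eq i i' (lshift (size s) i); rewrite -/(diag i) eii.
  by rewrite !eqxx andbT => /esym/eqP ->.
Qed.

(** If the link contained 1, then [alpha_0] would be a combination of the entries of [Y f]; the
    specialization [Y = 0] kills these entries and fixes the nonzero [alpha_0]. *)
Let link_proper : is_proper (generic_link g f I).
Proof.
move=> J1; have [Pa _ _] := Palpha; have [Ia a0 _] := Pa (Ordinal g_gt0).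
pose sp : 'I_N -> {mpoly K[n]} := fsum (fun i => 'X_i) (fun=> 0).
have : ideal_gen beta (incl (tnth alpha (Ordinal g_gt0))).
  rewrite -[X in ideal_gen _ X]mul1r; apply: J1.
  by rewrite mpoly_extE; apply: mem_extend_ideal.
suff spb : subideal (ideal_gen beta) (fun x => amap sp x = 0).
  move/spb; rewrite (@amap_inclX _ _ _ _ _ (fun i => 'X_i)); last first.
    by move=> i; rewrite /sp fsumE.
  by rewrite amap_id => e0; rewrite e0 eqxx in a0.
apply: ideal_gen_min.
  split=> [|a x y x0 y0]; first by rewrite rmorph0.
  by rewrite rmorphD rmorphM /= x0 y0 mulr0 addr0.
move=> _ /tnthP[i ->]; rewrite betaE rmorph_sum /= big1 // => j _.
by rewrite rmorphM /= amapX /sp fsumE mul0r.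
Qed.

Lemma generic_link_P (J := generic_link g f I) :
  [/\ unmixed J, homogeneous_ideal link_measure J, ideal_height J g
    & P_sequence link_measure J link_order beta].
Proof.
apply: P_sequence_colon link_order_term _ beta_P link_proper.
rewrite mpoly_extE link_generators extend_ideal_gen; apply: homogeneous_ideal_gen.
move=> _ /mapP[p /tnthP[j ->] ->]; apply/homogP; exists (e j).
exact: incl_homog.
Qed.

End GenericLinkStep.

(** * Iterated generic links and the two statements *)

Lemma P_sequenceW (K : fieldType) n (mf : measure n) (I : {mpoly K[n]} -> Prop)
    ord g (alpha : g.-tuple {mpoly K[n]}) :
  P_sequence mf I ord alpha -> P_sequence mf (fun=> True) ord alpha.
Proof. by case=> H1 H2 H3; split=> // i; case: (H1 i). Qed.

(** Each link again has height [g], the number of entries of [Y f], so one inequality [0 < g] serves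
    all steps and every sequence is a [g]-tuple. The clause [n <= m] allows the extensions of
    gradings to be composed. *)
Lemma nth_generic_link_P_exists (K : fieldType) n (mf : measure n)
    (I : {mpoly K[n]} -> Prop) ord g (alpha : g.-tuple {mpoly K[n]}) k :
  positive_grading mf -> unmixed I -> homogeneous_ideal mf I ->
  term_order ord -> ideal_height I g -> P_sequence mf I ord alpha ->
  k = 0%N \/ (0 < g)%N ->
  exists (m : nat) (J : {mpoly K[m]} -> Prop) (mf' : measure m) (ord' : rel 'X_{1..m})
      (alpha' : g.-tuple {mpoly K[m]}),
    [/\ [/\ (n <= m)%N, nth_generic_link I k J, positive_grading mf'
          & extends_grading mf mf'],
        unmixed J, homogeneous_ideal mf' J, ideal_height J g
      & term_order ord' /\ P_sequence mf' J ord' alpha'].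
Proof.
move=> mf_gt0 uI homI ho hI Pa k0.
elim: k k0 => [_|k IHk [//|g_gt0]].
  exists n, I, mf, ord, alpha; split=> //; split=> //; first exact: generic_link0.
  by move=> i j ij; congr (mf U_(_)%MM); apply: val_inj.
have [|m [J [mf' [ord' [alpha' [[le_nm L mf'_gt0 ext] uJ homJ hJ [ho' Pa']]]]]]] := IHk.
  by right.
have [idJ _ _] := uJ.
have [s [s_homog Js]] := homogeneous_basis idJ homJ.
have [uL homL hL PL] := generic_link_P idJ ho' Pa' g_gt0 s_homog Js.
pose f := cat_tuple alpha' (in_tuple s).
exists (m + g * (g + size s))%N, (generic_link g f J), (link_measure mf' alpha' s),
  (link_order (s := s) ord'), (generic_combinations g f).
split; [split|exact: uL|exact: homL|exact: hL|split; [|exact: PL]].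
- exact: leq_trans (leq_addr _ _).
- apply: generic_linkS => //.
  by rewrite -(link_generators idJ Pa' Js).
- exact: link_measure_positive.
- move=> i j ij; apply: (@etrans _ _ (mf' U_(widen_ord le_nm i)%MM)).
    exact: link_measure_extends.
  exact: ext.
- exact: link_order_term.
Qed.

Local Close Scope ring_scope.

Theorem lemma3p3 (K : fieldType) (n : nat) (mf : measure n)
    (I : {mpoly K[n]} -> Prop) (ord : rel 'X_{1..n}) (g : nat)
    (alpha : g.-tuple {mpoly K[n]}) :
  positive_grading mf ->
  unmixed I ->
  homogeneous_ideal mf I ->
  term_order ord ->
  ideal_height I g ->
  P_sequence mf I ord alpha ->
  (forall k : nat, k = 0 \/ 0 < g ->
     exists (m : nat) (J : {mpoly K[m]} -> Prop) (mf' : measure m),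
       [/\ nth_generic_link I k J,
           forall (m' : nat) (J' : {mpoly K[m']} -> Prop),
             nth_generic_link I k J' -> equivalent_ideals J' J,
           positive_grading mf' /\ extends_grading mf mf'
         & property_P mf' J])
  /\
  ((~ exists s : seq {mpoly K[n]},
        regular_sequence s /\ same_ideal I (ideal_gen s)) ->
     linked I (colon (ideal_gen alpha) I)
     /\ property_P mf (colon (ideal_gen alpha) I)).
Proof.
move=> mf_gt0 uI homI ho hI Pa; split=> [k k0|no_reg].
  have [m [J [mf' [ord' [alpha' [[_ L mf'_gt0 ext] uJ homJ hJ [ho' Pa']]]]]]] :=
    nth_generic_link_P_exists mf_gt0 uI homI ho hI Pa k0.
  exists m, J, mf'; split=> //.
    by move=> m' J' L'; apply/stably_equivalentW/(nth_generic_link_unique L' L).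
  by split=> //; exists ord', g, alpha'.
have [idI nI1 _] := uI.
have [cs sq] := P_sequence_coprime_initials Pa.
have sub_aI := P_sequence_sub idI Pa.
have proper_a : is_proper (ideal_gen alpha) by move/sub_aI.
(* [alpha] is itself a regular sequence, so the hypothesis on [I] excludes equality with the ideal
   it generates; this makes the colon proper. *)
have nIa : ~ same_ideal I (ideal_gen alpha).
  move=> Ia; apply: no_reg; exists alpha; split=> //.
  exact: squarefree_initials_regular cs proper_a.
have hI' : ideal_height I (size alpha) by rewrite size_tuple.
have [lI pJ] := squarefree_initials_linked ho cs sq proper_a sub_aI uI hI' nIa.
split; first exact: lI.
have [uJ homJ hJ PJ] := P_sequence_colon ho homI (P_sequenceW Pa) pJ.
by split=> //; exists ord, g, alpha.
Qed.
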